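(* Let $D$ be a finite or countable set, let $\lambda,\mu:D\to(0,\infty)$, and put $\rho(z)=\lambda(z)/\mu(z)$. For every $n\in\mathbb Z_+$ let $\mathbf T_n=(\tau_n(z,z'))_{z,z'\in D}$ be the generator of an irreducible continuous-time Markov chain on $D$. Let $(N,Z)$ be the continuous-time Markov process on $\mathbb Z_+\times D$ with generator matrix $\mathbf R$ given by $$R[(n,z),(n+1,z)]=\lambda(z),\qquad R[(n,z),(n-1,z)]=\mu(z)\ (n\ge 1),\qquad R[(n,z),(n,z')]=\rho^{-n}(z)\,\tau_n(z,z')\ (z'\ne z),$$ and $R[(n,z),(n',z')]=0$ whenever $n\ne n'$ and $z\ne z'$ (all other off-diagonal entries are also $0$). Assume: 1. For some function $v:D\to\mathbb R_+$ (not depending on $n$, not identically zero), for each $n\in\mathbb Z_+$ and $z\in D$, $$v(z)\sum_{z'\in D}\tau_n(z,z')=\sum_{z'\in D}v(z')\,\tau_n(z',z).$$ 2. $\rho(z)<1$ for all $z\in D$, and $$\Xi:=\sum_{z\in D}\frac{v(z)}{1-\rho(z)}=\sum_{n=0}^\infty\sum_{z\in D}\rho^n(z)v(z)<\infty .$$ Then the Markov process $(N,Z)$ is irreducible, aperiodic, and positive recurrent. It has an invariant probability measure $$\pi(n,z)=\eta(n,z)/\Xi,\qquad \eta(n,z):=\rho^n(z)\,v(z),\qquad (n,z)\in\mathbb Z_+\times D,$$ and its transition kernel $P_t(x,\cdot)$ converges to this invariant measure: $$\|P_t(x,\cdot)-\pi(\cdot)\|_{\mathrm{TV}}\to 0\quad\text{as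 } t\to\infty,\ \text{for all } x\in\mathbb Z_+\times D.$$
   Context: $\mathbb Z_+=\{0,1,2,\dots\}$, $\mathbb R_+=[0,\infty)$. For a signed measure $\nu$, $\|\nu\|_{\mathrm{TV}}:=\sup_A|\nu(A)|$. $N(t)$ is the number of jobs in an $M/M/1$ queue with arrival rate $\lambda(z)$ and service rate $\mu(z)$ when the environment $Z(t)$ is in state $z$; when the queue is in state $n$, the environment moves from $z$ to $z'$ at rate $\rho^{-n}(z)\tau_n(z,z')$. In condition 1 the sums may equivalently be taken over $z'\ne z$; the condition says that $v$ defines an invariant measure for the chain with generator $\mathbf T_n$, for every $n$.
   Formalization: The process (N,Z) is assumed non-explosive (paths in Z_+×D for all time, right-continuous with left limits, finitely many jumps in bounded time); this does not follow from conditions 1 and 2, and without it positive recurrence and convergence can fail. *)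

(* Defs.v *)
From HB Require Import structures.
From mathcomp Require Import all_boot all_order all_algebra.
From mathcomp Require Import all_classical all_reals all_analysis.

Set Implicit Arguments.
Unset Strict Implicit.
Unset Printing Implicit Defensive.

Import Order.TTheory GRing.Theory Num.Theory numFieldNormedType.Exports.
Local Open Scope classical_set_scope.
Local Open Scope ring_scope.

Section Generators.
Variables (R : realType) (S : countType).

(* Stable and conservative: in each row the off-diagonal entries have a finite
   sum, equal to minus the diagonal entry. *)
Definition is_generator (Q : S -> S -> R) : Prop :=
  (forall x y, x != y -> 0 <= Q x y) /\
  (forall x, \esum_(y in ~` [set x]) (Q x y)%:E = (- Q x x)%:E)%E.

Definition irreducible_generator (Q : S -> S -> R) : Prop :=
  forall x y, exists p : seq S, path (fun a b => 0 < Q a b) x p /\ last x p = y.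

(* Only the off-diagonal entries of [q] are used. *)
Definition generator_of_rates (q : S -> S -> R) (x y : S) : R :=
  if y == x then - fine (\esum_(w in ~` [set x]) (q x w)%:E)%E else q x y.

End Generators.

Section MarkovProcesses.
Variables (R : realType) (S : countType).
Variables (d : measure_display) (Omega : measurableType d).
Variables (X : R -> Omega -> S) (Pr : S -> probability Omega R).

(* The transition kernel P_t(x, A); only the times t >= 0 are relevant. *)
Definition transition (t : R) (x : S) (A : set S) : \bar R := Pr x (X t @^-1` A).

Definition past_event (h : seq (R * S)) : set Omega :=
  [set w | forall c, c \in h -> X c.1 w = c.2].

(* [X] is, under the laws [Pr x], a time-homogeneous Markov process with
   generator matrix [Q].  Right-continuity and the existence of left limits are
   for the discrete topology of [S]: they say that [X] is a pure jump process
   with finitely many jumps in bounded time, so the process does not explode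
   and has no cemetery state. *)
Record is_markov_process (Q : S -> S -> R) : Prop := IsMarkovProcess {
  markov_measurable : forall (t : R) (A : set S), 0 <= t ->
    measurable (X t @^-1` A) ;
  markov_right_continuous : forall (w : Omega) (t : R), 0 <= t ->
    \forall s \near t^'+, X s w = X t w ;
  markov_left_limit : forall (w : Omega) (t : R), 0 < t ->
    exists y, \forall s \near t^'-, X s w = y ;
  markov_start : forall x, Pr x (X 0 @^-1` [set x]) = 1%E ;
  markov_property : forall (x : S) (s t : R) (h : seq (R * S)) (y z : S),
    0 <= s -> 0 <= t -> (forall c, c \in h -> 0 <= c.1 <= s) ->
    Pr x (past_event h `&` (X s @^-1` [set y]) `&` (X (s + t) @^-1` [set z])) =
    (Pr x (past_event h `&` (X s @^-1` [set y])) * transition t y [set z])%E ;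
  markov_generator : forall x y : S,
    (fine (transition h x [set y]) - (x == y)%:R) / h @[h --> 0^'+] --> Q x y
}.

(* The first time at which the process is at [x] after having been elsewhere;
   +oo if there is no such time. *)
Definition return_time (x : S) (w : Omega) : \bar R :=
  ereal_inf [set t%:E | t in
    [set t : R | exists s, [/\ 0 <= s, s <= t, X s w <> x & X t w = x]]].

(* Finite mean return times; no provision is made for absorbing states. *)
Definition positive_recurrent : Prop :=
  forall x, (\int[Pr x]_w return_time x w < +oo)%E.

End MarkovProcesses.

Section TransitionKernels.
Variables (R : realType) (S : countType).
Variable (P : R -> S -> set S -> \bar R).

Definition irreducible_kernel : Prop :=
  forall x y, exists t : R, 0 < t /\ (0 < P t x [set y])%E.

(* Every skeleton chain with kernel P_h, h > 0, is aperiodic: each state has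
   period 1, the period being the gcd of the possible return times. *)
Definition aperiodic_kernel : Prop :=
  forall (h : R) (x : S), 0 < h ->
  forall k : nat,
    (forall n : nat, (0 < n)%N -> (0 < P (h *+ n) x [set x])%E -> (k %| n)%N) ->
    k = 1%N.

Definition mass_measure (p : S -> R) (A : set S) : \bar R :=
  (\esum_(x in A) (p x)%:E)%E.

Definition is_pmf (p : S -> R) : Prop :=
  (forall x, 0 <= p x) /\ mass_measure p setT = 1%E.

Definition invariant_for (p : S -> R) : Prop :=
  forall (t : R) (A : set S), 0 <= t ->
    (\esum_(x in setT) ((p x)%:E * P t x A) = mass_measure p A)%E.

Definition tv_norm (nu : set S -> \bar R) : \bar R :=
  ereal_sup [set `|nu A|%E | A in setT].

End TransitionKernels.

Section Queue.
Variables (R : realType) (D : countType).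
Variables (lambda mu : D -> R) (tau : nat -> D -> D -> R) (v : D -> R).

Definition rho (z : D) : R := lambda z / mu z.

Definition queue_rate (x y : nat * D) : R :=
  if y.2 == x.2 then
    if y.1 == x.1.+1 then lambda x.2
    else if x.1 == y.1.+1 then mu x.2
    else 0
  else if y.1 == x.1 then (rho x.2) ^- x.1 * tau x.1 x.2 y.2
  else 0.

Definition queue_generator : nat * D -> nat * D -> R :=
  generator_of_rates queue_rate.

Definition balanced : Prop :=
  forall (n : nat) (z : D),
    ((v z)%:E * (\esum_(z' in ~` [set z]) (tau n z z')%:E) =
     \esum_(z' in ~` [set z]) (v z' * tau n z' z)%:E)%E.

Definition eta (x : nat * D) : R := rho x.2 ^+ x.1 * v x.2.

Definition Xi : \bar R := (\esum_(z in setT) (v z / (1 - rho z))%:E)%E.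

Definition queue_pi (x : nat * D) : R := eta x / fine Xi.

End Queue.

(* Main.v *)
(* The weight eta(n, z) = rho(z)^n v(z) satisfies eta Q = 0.  The state space is
   exhausted by finite sets F: along the skeleton of step h, the part of the
   measure pi carried by the paths staying in F is multiplied by at most
   1 + e h at each step, so that pi P_t <= exp(e t) pi once F increases to the
   whole space, which is licit because a path has a finite range on [0, t].
   Hence pi P_t <= pi, with equality because both sides have mass 1.

   Positive recurrence: up to the time n, the expected number of visits of the
   unit-time skeleton from x to y before its return to x, after having left x,
   is at most c pi(y) with c = 1 / (pi(x) (1 - P_1(x, x))), by induction on n.

   Convergence: P_t(x, .) <= pi / pi(x), so the positive and negative parts of
   P_t(x, .) - pi are dominated by a multiple of pi.  As long as their common
   mass is at least e, half of it sits on a fixed finite set, from which all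
   entries of P_1 to a fixed state are bounded below, and the mass drops by a
   fixed amount in each unit of time. *)

Require Import Defs.
From HB Require Import structures.
From mathcomp Require Import all_boot all_order all_algebra.
From mathcomp Require Import all_classical all_reals all_analysis.
From mathcomp Require Import measurable_realfun ring lra.
Import Order.TTheory GRing.Theory Num.Theory numFieldNormedType.Exports.
Local Open Scope classical_set_scope.
Local Open Scope ring_scope.

Set Implicit Arguments.
Unset Strict Implicit.
Unset Printing Implicit Defensive.

(** * Sums, filters and integrals *)

Section EsumExtra.
Context {R : realType}.
Local Open Scope ereal_scope.

Lemma esum_le_seq (T : choiceType) (a : T -> \bar R) (c : \bar R) :
  (forall s : seq T, uniq s -> \sum_(i <- s) a i <= c) ->
  \esum_(i in [set: T]) a i <= c.
Proof.
move=> h; apply: ge_ereal_sup => _ [F [finF _] <-].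
by rewrite fsbig_finite//; apply: h; exact: finmap.fset_uniq.
Qed.

Lemma seq_le_esum (T : choiceType) (a : T -> \bar R) (s : seq T) :
  (forall i, 0 <= a i) -> uniq s ->
  \sum_(i <- s) a i <= \esum_(i in [set: T]) a i.
Proof.
move=> a0 us; apply: ereal_sup_ubound; exists [set` s].
  by split=> //; exact: finite_seq.
by rewrite -fsbig_seq.
Qed.

Lemma esumZl (T : choiceType) (D : set T) (r : R) (a : T -> \bar R) :
  (0 <= r)%R -> (forall i, 0 <= a i) ->
  \esum_(i in D) (r%:E * a i) = r%:E * \esum_(i in D) a i.
Proof.
move=> r0 a0; rewrite /esum -ereal_supZl//; last first.
  apply/set0P; exists 0; exists set0; first exact: fsets_set0.
  by rewrite fsbig_set0.
congr ereal_sup; apply/seteqP; split=> [_ [F DF <-]|_ [_ [F DF <-] <-]] /=.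
  by exists (\sum_(x \in F) a x); [exists F|rewrite ge0_mule_fsumr].
by exists F; rewrite // ge0_mule_fsumr.
Qed.

Lemma le_esum1 (T : choiceType) (D : set T) (a : T -> \bar R) (x : T) :
  D x -> (forall i, 0 <= a i) -> a x <= \esum_(i in D) a i.
Proof.
move=> Dx a0; apply: ereal_sup_ubound; exists [set x]; last by rewrite fsbig_set1.
by split; [exact: finite_set1|move=> y ->].
Qed.

Lemma esum_exchange (T1 T2 : choiceType) (D1 : set T1) (D2 : set T2)
    (a : T1 -> T2 -> \bar R) : (forall i j, 0 <= a i j) ->
  \esum_(i in D1) \esum_(j in D2) a i j = \esum_(j in D2) \esum_(i in D1) a i j.
Proof.
move=> a0; rewrite !esum_esum//.
rewrite (reindex_esum (D2 `*`` fun=> D1) _ (fun x => (x.2, x.1)))//; split=> //=.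
- by move=> [i j] [/=].
- by move=> [i1 i2] [j1 j2] /= _ _ [] -> ->.
- by move=> [i1 i2] [Pi1 Qi2] /=; exists (i2, i1).
Qed.

Lemma le_esum_subset (T : choiceType) (A B : set T) (a : T -> \bar R) :
  A `<=` B -> \esum_(i in A) a i <= \esum_(i in B) a i.
Proof.
move=> AB; apply: le_ereal_sup => _ [F [finF FA] <-].
by exists F => //; split=> //; exact: subset_trans AB.
Qed.

(** Countable additivity over the fibres of [Y], indexed by [nat] through [pickle]. It is applied to
    a single state and to whole sequences of states. *)
Lemma measure_fibers d (T : measurableType d) (mu : {measure set T -> \bar R})
    (C : countType) (E : set T) (Y : T -> C) (B : set C) :
  measurable E -> (forall c, measurable (Y @^-1` [set c])) ->
  mu (E `&` Y @^-1` B) = \esum_(c in B) mu (E `&` Y @^-1` [set c]).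
Proof.
move=> mE mY.
pose F n := E `&` [set w | pickle (Y w) = n].
have FE c : F (pickle c) = E `&` Y @^-1` [set c].
  apply/seteqP; split=> w [Ew]; rewrite /F /= => Yw; split=> //=.
    exact: (pcan_inj pickleK).
  by rewrite Yw.
have -> : E `&` Y @^-1` B = \bigcup_(n in pickle @` B) F n.
  apply/seteqP; split=> [w [Ew BYw]|w [_ [c Bc <-]]].
    by exists (pickle (Y w)); [exists (Y w)|].
  by rewrite FE => -[Ew /= Yw]; split=> //=; rewrite Yw.
rewrite measure_bigcup; last first.
- by move=> i j _ _ [w [[_ <-] [_ <-]]].
- by move=> _ [c _ <-]; rewrite FE; apply: measurableI.
rewrite nneseries_esum// (_ : [set x | x \in _] = pickle @` B); last first.
  by apply/seteqP; split=> x; rewrite /= inE.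
rewrite esum_image//; last first.
  by move=> x y _ _; exact: (pcan_inj pickleK).
by apply: eq_esum => c _; rewrite FE.
Qed.

Lemma measurable_fibers d (T : measurableType d) (C : countType) (Y : T -> C)
    (B : set C) :
  (forall c, measurable (Y @^-1` [set c])) -> measurable (Y @^-1` B).
Proof.
move=> mY; have -> : Y @^-1` B = \bigcup_(c in B) (Y @^-1` [set c]).
  by apply/seteqP; split=> [w Bw|w [c Bc /= ->//]]; exists (Y w).
rewrite bigcup_mkcond; apply: countable_bigcupT_measurable => [|c]; [exact: countableP|by case: ifP].
Qed.

End EsumExtra.

Lemma esum_seq {R : realType} (T : choiceType) (s : seq T) (a : T -> \bar R) :
  uniq s -> (forall i, (0 <= a i)%E) -> (forall i, i \notin s -> a i = 0%E) ->
  (\esum_(i in [set: T]) a i = \sum_(i <- s) a i)%E.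
Proof.
move=> us a0 as0; rewrite (esumID [set` s])// !setTI [X in (_ + X)%E]esum1; last first.
  by move=> i /negP/as0.
rewrite adde0 fsbig_seq// -esum_fset//.
Qed.

Lemma cvg_sumr_seq {R : realType} (T I : Type) (F : set_system T) {FF : Filter F}
    (s : seq I) (f : I -> T -> R) (l : I -> R) :
  (forall i, f i x @[x --> F] --> l i) ->
  \sum_(i <- s) f i x @[x --> F] --> \sum_(i <- s) l i.
Proof.
move=> fl; elim: s => [|i s IH].
  by under eq_fun do rewrite big_nil; rewrite big_nil; exact: cvg_cst.
by under eq_fun do rewrite big_cons; rewrite big_cons; exact: cvgD.
Qed.

Lemma near_all_seq (T : Type) (I : eqType) (F : set_system T) {FF : Filter F}
    (s : seq I) (P : I -> T -> Prop) :
  (forall i, i \in s -> \forall x \near F, P i x) ->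
  \forall x \near F, forall i, i \in s -> P i x.
Proof.
elim: s => [_|i s IH h]; first exact: nearW.
have hs j : j \in s -> \forall x \near F, P j x.
  by move=> js; apply: h; rewrite in_cons js orbT.
apply: filterS2 (IH hs) (h i (mem_head _ _)) => x Ps Pi j.
by rewrite in_cons => /predU1P[->//|/Ps].
Qed.

Lemma sume_seq_subset {R : realType} (T : choiceType) (r s : seq T) (a : T -> \bar R) :
  uniq r -> uniq s -> {subset r <= s} -> (forall i, (0 <= a i)%E) ->
  (\sum_(i <- r) a i <= \sum_(i <- s) a i)%E.
Proof.
move=> ur us rs a0; rewrite (fsbig_seq _ _ ur) (fsbig_seq _ _ us).
apply: lee_fsum_nneg_subset => //; do 1?exact: finite_seq.
by apply/subsetP => i; exact: rs.
Qed.

(** Realizes a property of all small steps by a step that divides [t], so that [t] is itself a point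
    of the grid. *)
Lemma near0_fraction {R : realType} (P : R -> Prop) (t : R) : 0 < t ->
  (\forall h \near 0^'+, P h) -> exists n : nat, P (t / n.+1%:R).
Proof.
move=> t0 [e/= e0 he]; exists (Num.truncn (t / e)).
set n := Num.truncn _.
have hn0 : 0 < t / n.+1%:R by rewrite divr_gt0.
apply: he => //; rewrite /ball/= sub0r normrN gtr0_norm// ltr_pdivrMr// mulrC.
by rewrite -ltr_pdivrMr// truncnS_gt.
Qed.

Section EnumBelow.
Context {S : countType}.

(** The finite sets exhausting the state space: they increase with [m], and every finite set of
    states lies in one of them. *)
Definition enum_below (m : nat) : seq S := pmap (@pickle_inv S) (iota 0 m).

Lemma enum_below_uniq (m : nat) : uniq (enum_below m).
Proof. by apply: (pmap_uniq (@pickle_invK S)); exact: iota_uniq. Qed.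

Lemma mem_enum_below (m : nat) (y : S) : (y \in enum_below m) = (pickle y < m)%N.
Proof.
rewrite mem_pmap; apply/mapP/idP => [[n]|ym].
  rewrite mem_iota add0n => /andP[_ nm] e.
  by have := @pickle_invK S n; rewrite -e /= => ->.
by exists (pickle y); rewrite ?pickleK_inv// mem_iota.
Qed.

End EnumBelow.

(** The differences [b i - a i] are nonnegative, and their sum is 0 because the common sum is finite
    and can be cancelled. *)
Lemma le_esum_eq {R : realType} (T : choiceType) (a b : T -> R) :
  (forall i, 0 <= a i) -> (forall i, a i <= b i) ->
  (\esum_(i in [set: T]) (a i)%:E = \esum_(i in [set: T]) (b i)%:E)%E ->
  (\esum_(i in [set: T]) (b i)%:E < +oo)%E -> forall i, a i = b i.
Proof.
move=> a0 ab eab bfin i.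
have sum_fin : \esum_(i in [set: T]) (a i)%:E \is a fin_num.
  by rewrite ge0_fin_numE ?eab// esum_ge0// => j _; rewrite lee_fin (le_trans (a0 j)).
apply/eqP; rewrite eq_le ab -subr_le0 -lee_fin /=.
apply: (@le_trans _ _ (\esum_(i in [set: T]) (b i - a i)%:E)%E).
  by apply: (@le_esum1 _ _ _ (fun i => (b i - a i)%:E)) => // j; rewrite lee_fin subr_ge0.
rewrite -(leeD2lE _ _ sum_fin) -esumD => [|j _|j _]; rewrite ?lee_fin ?subr_ge0//.
by rewrite adde0 eab; apply: le_esum => j _; rewrite -EFinD subrKC.
Qed.

(** The integral of a nonnegative function is a supremum over the simple functions below it, so
    monotonicity holds without measurability. This allows bounding the integral of [return_time]
    directly. *)
Lemma ge0_le_integral_gen d (T : measurableType d) (R : realType)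
    (mu : {measure set T -> \bar R}) (f g : T -> \bar R) :
  (forall x, (0 <= f x)%E) -> (forall x, (f x <= g x)%E) ->
  (\int[mu]_x f x <= \int[mu]_x g x)%E.
Proof.
move=> f0 fg; rewrite !ge0_integralTE//; last by move=> x; exact: le_trans (fg x).
by apply: le_ereal_sup => _ [h hf <-]; exists h => // x; exact: le_trans (fg x).
Qed.

Lemma seq_lower_bound {R : realType} (T : eqType) (s : seq T) (f : T -> R) :
  (forall y, 0 < f y) -> exists2 k, 0 < k & forall y, y \in s -> k <= f y.
Proof.
move=> f0; elim: s => [|z s [k k0 kf]]; first by exists 1.
exists (Num.min k (f z)); first by rewrite lt_min k0 f0.
move=> y; rewrite inE => /predU1P[->|/kf ky]; first by rewrite ge_min lexx orbT.
by rewrite ge_min ky.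
Qed.

(** The total mass is a supremum of finite sums, so one of them comes within [e] of it. *)
Lemma esum_tail {R : realType} (T : choiceType) (p : T -> R) (e : R) :
  (forall y, 0 <= p y) -> (\esum_(y in [set: T]) (p y)%:E = 1)%E -> 0 < e ->
  exists2 s : seq T, uniq s & 1 - e <= \sum_(y <- s) p y.
Proof.
move=> p0 p1 e0.
have [|_ [F [finF _] <-]] := @ub_ereal_sup_adherent R
    [set (\sum_(y \in A) (p y)%:E)%E | A in fsets [set: T]] e e0.
  by rewrite [ereal_sup _]p1.
rewrite [ereal_sup _]p1 fsbig_finite// sumEFin -EFinB lte_fin => /ltW h.
by exists (finmap.enum_fset (fset_set F)) => //; exact: finmap.fset_uniq.
Qed.

(** * Markov property along finite samples *)

Section MarkovProcess.
Context {R : realType} {S : countType} {d : measure_display}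
  {Omega : measurableType d}.
Variables (X : R -> Omega -> S) (Pr : S -> probability Omega R) (Q : S -> S -> R).
Hypothesis MX : is_markov_process X Pr Q.

Definition kernel (t : R) (x y : S) : R := fine (transition X Pr t x [set y]).

Definition sample (ts : seq R) (w : Omega) : seq S := [seq X t w | t <- ts].

Lemma measurable_sample (ts : seq R) (p : seq S) :
  (forall t, t \in ts -> 0 <= t) -> measurable (sample ts @^-1` [set p]).
Proof.
elim: ts p => [|t ts IH] [|y p] ts0.
- by rewrite [X in measurable X](_ : _ = setT)//; apply/seteqP; split.
- by rewrite [X in measurable X](_ : _ = set0)//; apply/seteqP; split.
- by rewrite [X in measurable X](_ : _ = set0)//; apply/seteqP; split.
- rewrite [X in measurable X](_ : _ =
    X t @^-1` [set y] `&` sample ts @^-1` [set p]); last first.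
    by apply/seteqP; split=> [w [<- <-]|w [/= <- <-]].
  apply: measurableI; first by apply: markov_measurable MX _ _ _; rewrite ts0 ?mem_head.
  by apply: IH => u us; rewrite ts0// in_cons us orbT.
Qed.

Lemma measurable_sample_event (ts : seq R) (B : set (seq S)) :
  (forall t, t \in ts -> 0 <= t) -> measurable (sample ts @^-1` B).
Proof. by move=> ts0; apply: measurable_fibers => p; exact: measurable_sample. Qed.

Lemma sample_past_event (ts : seq R) (p : seq S) : size ts = size p ->
  sample ts @^-1` [set p] = past_event X (zip ts p).
Proof.
elim: ts p => [|t ts IH] [|y p]//= => [_|[/IH e]].
  by apply/seteqP; split.
apply/seteqP; split=> w.
  move=> [<- pE] c; rewrite in_cons => /orP[/eqP ->//|].
  have : past_event X (zip ts p) w by rewrite -e.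
  exact.
move=> h; rewrite /= (h (t, y)) ?mem_head//; congr cons.
suff : past_event X (zip ts p) w by rewrite -e.
by move=> c cp; apply: h; rewrite in_cons cp orbT.
Qed.

Lemma kernelE (t : R) (x y : S) : 0 <= t ->
  transition X Pr t x [set y] = (kernel t x y)%:E.
Proof.
by move=> t0; rewrite fineK// fin_num_measure//; exact: markov_measurable MX _ _ _.
Qed.

(** The Markov property is given for pasts with prescribed values; the past described by a set [B]
    of sequences is a countable disjoint union of such pasts, over which both sides are summed. *)
Lemma markov_property_sample (x : S) (s t : R) (ts : seq R) (B : set (seq S))
    (y z : S) : 0 <= s -> 0 <= t -> (forall u, u \in ts -> 0 <= u <= s) ->
  (Pr x (sample ts @^-1` B `&` (X s @^-1` [set y]) `&` (X (s + t) @^-1` [set z])) =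
  Pr x (sample ts @^-1` B `&` (X s @^-1` [set y])) * (kernel t y z)%:E)%E.
Proof.
move=> s0 t0 tss.
have ts0 u : u \in ts -> 0 <= u by case/tss/andP.
have mX u A : 0 <= u -> measurable (X u @^-1` A).
  exact: markov_measurable MX _ _.
pose E := X s @^-1` [set y] `&` X (s + t) @^-1` [set z].
have mE : measurable E by apply: measurableI; apply: mX; rewrite ?addr_ge0.
rewrite -setIA -/E [_ `&` E]setIC [in RHS]setIC.
rewrite measure_fibers//; last by move=> p; exact: measurable_sample.
rewrite [in RHS]measure_fibers//; last 2 first.
  exact: mX.
  by move=> p; exact: measurable_sample.
rewrite muleC -esumZl//; last by rewrite fine_ge0.
apply: eq_esum => p _; have [szp|szp] := eqVneq (size ts) (size p); last first.
  have -> : sample ts @^-1` [set p] = set0.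
    rewrite -subset0 => w /= /(congr1 size) /eqP.
    by rewrite size_map (negbTE szp).
  by rewrite !setI0 measure0 mule0.
rewrite muleC -kernelE// sample_past_event// [in RHS]setIC.
rewrite -(markov_property MX)// => [|c /(map_f fst) ].
  by congr (Pr x _); rewrite /E; apply/seteqP; split=> w /=; tauto.
by rewrite -/(unzip1 _) unzip1_zip ?szp// => /tss.
Qed.

Lemma markov_property_sum (x : S) (s t : R) (ts : seq R) (B : set (seq S))
    (z : S) : 0 <= s -> 0 <= t -> (forall u, u \in ts -> 0 <= u <= s) ->
  (Pr x (sample ts @^-1` B `&` X (s + t) @^-1` [set z]) =
  \esum_(y in [set: S])
    (Pr x (sample ts @^-1` B `&` X s @^-1` [set y]) * (kernel t y z)%:E))%E.
Proof.
move=> s0 t0 tss.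
have ts0 u : u \in ts -> 0 <= u by case/tss/andP.
have mX u A : 0 <= u -> measurable (X u @^-1` A).
  exact: markov_measurable MX _ _.
set E := _ `&` _.
rewrite (_ : E = E `&` X s @^-1` setT); last by rewrite preimage_setT setIT.
rewrite measure_fibers//; last 2 first.
- apply: measurableI; first exact: measurable_sample_event.
  by apply: mX; rewrite addr_ge0.
- by move=> c; exact: mX.
apply: eq_esum => y _; rewrite -markov_property_sample//.
by rewrite /E setIAC.
Qed.

Lemma kernel_ge0 (t : R) (x y : S) : 0 <= kernel t x y.
Proof. by rewrite fine_ge0. Qed.

Lemma transition_esum (t : R) (x : S) (A : set S) : 0 <= t ->
  transition X Pr t x A = (\esum_(y in A) (kernel t x y)%:E)%E.
Proof.
move=> t0; have mX B : measurable (X t @^-1` B) by exact: markov_measurable MX _ _ _.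
rewrite /transition -[X t @^-1` A]setTI measure_fibers//.
by apply: eq_esum => y _; rewrite setTI -kernelE.
Qed.

Lemma kernel_sum1 (t : R) (x : S) : 0 <= t ->
  (\esum_(y in [set: S]) (kernel t x y)%:E = 1)%E.
Proof.
by move=> t0; rewrite -transition_esum// /transition preimage_setT probability_setT.
Qed.

(** The Chapman-Kolmogorov equation, from the Markov property with an empty past. *)
Lemma kernelD (s t : R) (x z : S) : 0 <= s -> 0 <= t ->
  (kernel (s + t) x z)%:E = (\esum_(y in [set: S]) (kernel s x y * kernel t y z)%:E)%E.
Proof.
move=> s0 t0; rewrite -kernelE ?addr_ge0// /transition.
have /(_ s t [::] setT z) := markov_property_sum x.
rewrite !preimage_setT !setTI => ->//.
by apply: eq_esum => y _; rewrite setTI EFinM -(kernelE x y s0).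
Qed.

Lemma kernelD_ge (s t : R) (x y z : S) : 0 <= s -> 0 <= t ->
  kernel s x y * kernel t y z <= kernel (s + t) x z.
Proof.
move=> s0 t0; rewrite -lee_fin kernelD//.
apply: (@le_esum1 _ _ _ (fun y => (kernel s x y * kernel t y z)%:E)) => // u.
by rewrite lee_fin mulr_ge0 ?kernel_ge0.
Qed.

Lemma kernel0 (x y : S) : kernel 0 x y = (x == y)%:R.
Proof.
have xx : kernel 0 x x = 1 by rewrite /kernel /transition (markov_start MX).
have [<-//|xy] := eqVneq x y.
have := kernel_sum1 x (lexx 0); rewrite (esumID [set x])// => [|u _]; last first.
  by rewrite lee_fin kernel_ge0.
rewrite setTI setTI esum_set1 ?lee_fin ?kernel_ge0// xx.
move=> e; apply/eqP; rewrite eq_le kernel_ge0 andbT -lee_fin.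
apply: (@le_trans _ _ (\esum_(i in ~` [set x]) (kernel 0 x i)%:E)%E).
  apply: (@le_esum1 _ _ _ (fun y => (kernel 0 x y)%:E)) => [|u].
    by apply/eqP; rewrite eq_sym.
  by rewrite lee_fin kernel_ge0.
by rewrite -(@leeD2lE _ 1%:E)// e adde0.
Qed.

End MarkovProcess.

(** * Strict positivity of transition probabilities *)

Section Positivity.
Context {R : realType} {S : countType} {d : measure_display}
  {Omega : measurableType d}.
Variables (X : R -> Omega -> S) (Pr : S -> probability Omega R) (Q : S -> S -> R).
Hypothesis MX : is_markov_process X Pr Q.

Local Notation kernel := (kernel X Pr).

Lemma cvg_kernel_rate (x y : S) :
  (kernel h x y - (x == y)%:R) / h @[h --> 0^'+] --> Q x y.
Proof. exact: (markov_generator MX). Qed.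

Lemma kernel_diag_exp (h : R) (x : S) (n : nat) : 0 <= h ->
  kernel h x x ^+ n <= kernel (h *+ n) x x.
Proof.
move=> h0; elim: n => [|n IH]; first by rewrite expr0 mulr0n (kernel0 MX) eqxx.
rewrite exprS mulrS; apply: le_trans (kernelD_ge MX _ x _ h0 (mulrn_wge0 n h0)).
by rewrite ler_wpM2l// kernel_ge0.
Qed.

(** The difference quotient on the diagonal converges; multiplied by [h] it tends to 0, hence
    [kernel h x x] tends to 1. *)
Lemma kernel_diag_near (x : S) : \forall h \near 0^'+, 0 < kernel h x x.
Proof.
suff /cvgrPdist_lt/(_ 1 ltr01) : kernel h x x @[h --> 0^'+] --> (1 : R).
  apply: filterS => h; apply: contraTT; rewrite -!leNgt => h0.
  by rewrite ger0_norm; lra.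
have h0 : (h : R) @[h --> 0^'+] --> (0 : R) by exact/cvg_at_right_filter/cvg_id.
have : (kernel h x x - 1) / h * h + 1 @[h --> 0^'+] --> Q x x * 0 + 1.
  apply: cvgD; last exact: cvg_cst.
  by apply: cvgM h0; have := @cvg_kernel_rate x x; rewrite eqxx.
rewrite mulr0 add0r; apply: cvg_trans; apply: near_eq_cvg.
near=> h; have h_neq0 : h != 0 by near: h; exact: nbhs_right_neq.
by rewrite divfK// subrK.
Unshelve. all: by end_near. Qed.

(** Cut [t] into equal steps, each so short that being at [x] again at its end has positive
    probability. *)
Lemma kernel_diag_gt0 (t : R) (x : S) : 0 <= t -> 0 < kernel t x x.
Proof.
rewrite le_eqVlt => /predU1P[<-|t0]; first by rewrite (kernel0 MX) eqxx.
have [n hn] := near0_fraction t0 (kernel_diag_near x).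
have hn0 : 0 <= t / n.+1%:R by rewrite divr_ge0// ltW.
have := kernel_diag_exp x n.+1 hn0.
have -> : t / n.+1%:R *+ n.+1 = t by rewrite -(mulr_natr (t / n.+1%:R)) divfK.
by apply: lt_le_trans; rewrite exprn_gt0.
Qed.

Lemma kernel_gt0_trans (x y z : S) :
  (forall t, 0 < t -> 0 < kernel t x y) -> (forall t, 0 < t -> 0 < kernel t y z) ->
  forall t, 0 < t -> 0 < kernel t x z.
Proof.
move=> xy yz t t0; have t20 : 0 < t / 2 by rewrite divr_gt0.
have := kernelD_ge MX x y z (ltW t20) (ltW t20); rewrite -splitr.
by apply: lt_le_trans; rewrite mulr_gt0// (xy, yz).
Qed.

(** The rate makes [kernel h x y] positive for some [h < t]; over the remaining time [t - h],
    [kernel_diag_gt0] applies at [y]. *)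
Lemma kernel_gt0_rate (x y : S) : 0 < Q x y ->
  forall t, 0 < t -> 0 < kernel t x y.
Proof.
move=> Qxy t t0; have [->|xy] := eqVneq x y; first exact/kernel_diag_gt0/ltW.
have [h [h0 ht hxy]] : exists h, [/\ 0 < h, h < t & 0 < kernel h x y].
  have gt0 : \forall h \near 0^'+, 0 < (kernel h x y - (x == y)%:R) / h.
    exact: cvgr_gt (@cvg_kernel_rate x y) _ Qxy.
  near (0 : R)^'+ => h.
  have h0 : 0 < h by near: h; exact: nbhs_right_gt.
  have ht : h < t by near: h; exact: nbhs_right_lt.
  have : 0 < (kernel h x y - (x == y)%:R) / h by near: h.
  by rewrite (negbTE xy) subr0 pmulr_lgt0 ?invr_gt0//; exists h.
have := kernelD_ge MX x y y (ltW h0) (_ : 0 <= t - h).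
rewrite subr_ge0 ltW// subrKC => /(_ isT); apply: lt_le_trans.
by rewrite mulr_gt0// kernel_diag_gt0// subr_ge0 ltW.
Unshelve. all: by end_near. Qed.

End Positivity.

(** * Subinvariant measures *)

Section SubInvariance.
Context {R : realType} {S : countType} {d : measure_display}
  {Omega : measurableType d}.
Variables (X : R -> Omega -> S) (Pr : S -> probability Omega R) (Q : S -> S -> R).
Hypothesis MX : is_markov_process X Pr Q.

Local Notation kernel := (kernel X Pr).

(** Near each time the path takes at most two values, by right-continuity and the existence of a
    left limit. Compactness of the segment turns these local bounds on the codes into a single
    one. *)
Lemma path_range_finite (w : Omega) (t : R) :
  exists m, forall s, 0 <= s <= t -> X s w \in enum_below m.
Proof.
have /compact_near_coveringP cpt := @segment_compact R 0 t.
have := cpt nat \oo (fun m s => 0 <= s -> X s w \in enum_below m) _.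
case=> [s /= | m _ hm].
  rewrite in_itv/= => /andP[s0 _].
  (* At [s = 0] no time [u >= 0] lies to the left, so any [y] will do. *)
  have [y hy] : exists y, \forall u \near s^'-, 0 <= u -> X u w = y.
    move: s0; rewrite le_eqVlt => /predU1P[<-|s0]; last first.
      by have [y hy] := markov_left_limit MX w s0; exists y; apply: filterS hy.
    exists (X 0 w); near=> u => u0; exfalso.
    by move: u0; apply/negP; rewrite -ltNge; near: u; exact: nbhs_left_lt.
  pose m0 := maxn (pickle y) (pickle (X s w)).
  have hs : \forall u \near s, 0 <= u -> (pickle (X u w) <= m0)%N.
    have hyl : \forall u \near s, u < s -> 0 <= u -> X u w = y by exact: hy.
    have hyr : \forall u \near s, s < u -> X u w = X s w.
      exact: (markov_right_continuous MX w s0).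
    apply: filterS2 hyl hyr => u hl hr u0.
    case: (ltgtP u s) => us; first by rewrite (hl us u0) leq_maxl.
      by rewrite (hr us) leq_maxr.
    by rewrite us leq_maxr.
  exists ([set u | 0 <= u -> (pickle (X u w) <= m0)%N], [set i | (m0 < i)%N]).
    by split=> //; exists m0.+1.
  by move=> [u i] [/= um mi] /um um'; rewrite mem_enum_below (leq_ltn_trans um').
exists m => s /andP[s0 st]; apply: (hm m (leqnn _)) => //=.
by rewrite in_itv/= s0.
Unshelve. all: by end_near. Qed.

Definition grid (h : R) (n : nat) : seq R := [seq h *+ j | j <- iota 0 n.+1].

Lemma grid_bound (h : R) (n : nat) : 0 <= h ->
  forall u, u \in grid h n -> 0 <= u <= h *+ n.
Proof.
move=> h0 u /mapP[j]; rewrite mem_iota add0n ltnS => /andP[_ jn] ->.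
by rewrite mulrn_wge0// ler_wpMn2l.
Qed.

(** Only the grid points are constrained: the event is then measurable, and the Markov property can
    be used at each step. *)
Definition confined (s : seq S) (h : R) (n : nat) : set Omega :=
  sample X (grid h n) @^-1` [set p : seq S | {subset p <= s}].

Lemma measurable_confined (s : seq S) (h : R) (n : nat) : 0 <= h ->
  measurable (confined s h n).
Proof.
by move=> h0; apply: (measurable_sample_event MX) => u /(grid_bound h0)/andP[].
Qed.

Lemma confinedP (s : seq S) (h : R) (n : nat) (w : Omega) :
  confined s h n w <-> forall j, (j <= n)%N -> X (h *+ j) w \in s.
Proof.
split=> [H j jn|H y /mapP[u /mapP[j + ->] ->]].
  by apply: H; do 2 apply: map_f; rewrite mem_iota.
by rewrite mem_iota add0n ltnS => /H.
Qed.

(** Taboo probabilities: arrival in [z] at the end of the grid without having been seen outside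
    [s]. *)
Let q (s : seq S) (h : R) (n : nat) (y z : S) : R :=
  fine (Pr y (confined s h n `&` X (h *+ n) @^-1` [set z])).

Let qE (s : seq S) (h : R) (n : nat) (y z : S) : 0 <= h ->
  Pr y (confined s h n `&` X (h *+ n) @^-1` [set z]) = (q s h n y z)%:E.
Proof.
move=> h0; rewrite fineK// fin_num_measure//; apply: measurableI.
  exact: measurable_confined.
by apply: (markov_measurable MX); rewrite mulrn_wge0.
Qed.

Let q_ge0 (s : seq S) (h : R) (n : nat) (y z : S) : 0 <= q s h n y z.
Proof. by rewrite fine_ge0. Qed.

(** Dropping the constraint at the last grid point enlarges the event. The Markov property at time
    [h *+ n] then gives a sum over all states, of which confinement keeps only those in [s]. *)
Let q_rec (s : seq S) (h : R) (n : nat) (y z : S) : 0 <= h -> uniq s ->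
  q s h n.+1 y z <= \sum_(u <- s) q s h n y u * kernel h u z.
Proof.
move=> h0 us; rewrite -lee_fin -qE//.
have hn0 : 0 <= h *+ n by rewrite mulrn_wge0.
have := markov_property_sum MX y [set p : seq S | {subset p <= s}] z hn0 h0 (grid_bound h0).
rewrite -/(confined s h n) (esum_seq us) => [e|u|u us']; last 2 first.
- by rewrite mule_ge0// lee_fin kernel_ge0.
- rewrite (_ : _ `&` _ = set0) ?measure0 ?mul0e//.
  rewrite -subset0 => w [/confinedP/(_ n (leqnn n))] + /= uE.
  by rewrite uE (negbTE us').
apply: (@le_trans _ _ (Pr y (confined s h n `&` X (h *+ n + h) @^-1` [set z]))).
  apply: le_measure; rewrite ?inE.
  - apply: measurableI; first exact: measurable_confined.
    by apply: (markov_measurable MX); rewrite mulrn_wge0.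
  - apply: measurableI; first exact: measurable_confined.
    by apply: (markov_measurable MX); rewrite addr_ge0.
  - rewrite -mulrSr; apply: setSI => w /confinedP H.
    by apply/confinedP => j jn; apply: H; rewrite (leq_trans jn).
by rewrite e -sumEFin; under eq_bigr do rewrite qE// -EFinM.
Qed.

(** Induction on [n]: the confined mass at each [u] in [s] is at most [(1 + e) ^+ n * pi u], and the
    one-step hypothesis adds one more factor [1 + e]. *)
Lemma confined_subinvariant (pi : S -> R) (s : seq S) (h e : R) (n : nat) :
  0 <= h -> 0 <= e -> uniq s -> (forall y, 0 <= pi y) ->
  (forall z, z \in s -> \sum_(y <- s) pi y * kernel h y z <= (1 + e) * pi z) ->
  forall z, z \in s ->
    (\sum_(y <- s) (pi y)%:E * Pr y (confined s h n `&` X (h *+ n) @^-1` [set z])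
      <= ((1 + e) ^+ n * pi z)%:E)%E.
Proof.
move=> h0 e0 us pi0 hpi.
suff H z : z \in s -> \sum_(y <- s) pi y * q s h n y z <= (1 + e) ^+ n * pi z.
  by move=> z /H; rewrite -lee_fin -sumEFin; under eq_bigr do rewrite EFinM -qE//.
have e10 : 0 <= 1 + e by rewrite addr_ge0.
elim: n z => [|n IH] z zs.
  (* At time 0 the path is almost surely at its starting point, so only [y = z] contributes. *)
  rewrite expr0 mul1r (bigD1_seq z)//= big1 ?addr0 => [|y yz]; last first.
    rewrite (_ : q s h 0 y z = 0) ?mulr0//; apply/eqP.
    have <- : kernel 0 y z = 0 by rewrite (kernel0 MX) (negbTE yz).
    rewrite eq_le; apply/andP; split; last first.
      by rewrite (kernel0 MX) (negbTE yz) q_ge0.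
    rewrite -lee_fin -qE// -(kernelE MX)//; apply: le_measure; rewrite ?inE//.
    - apply: measurableI; first exact: measurable_confined.
      by apply: (markov_measurable MX).
    - by apply: (markov_measurable MX).
  rewrite ler_piMr// -lee_fin -qE//; apply: probability_le1; apply: measurableI.
    exact: measurable_confined.
  by apply: (markov_measurable MX).
apply: (@le_trans _ _ (\sum_(y <- s) pi y * \sum_(u <- s) q s h n y u * kernel h u z)).
  by apply: ler_sum => y _; rewrite ler_wpM2l// q_rec.
under eq_bigr do rewrite mulr_sumr.
rewrite exchange_big/=.
apply: (@le_trans _ _ (\sum_(u <- s) (1 + e) ^+ n * (pi u * kernel h u z))).
  rewrite big_seq [leRHS]big_seq; apply: ler_sum => u us'.
  under eq_bigr do rewrite mulrA.
  by rewrite -mulr_suml mulrA ler_wpM2r// ?kernel_ge0// IH.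
by rewrite -mulr_sumr exprSr -mulrA ler_wpM2l ?exprn_ge0// hpi.
Qed.

(** The difference quotients of the finite sum converge to a limit [<= 0], which is strictly below
    [e * pi z]. Since [s] is finite, one range of [h] serves all its [z]. *)
Lemma near_subinvariant (pi : S -> R) (s : seq S) (e : R) :
  uniq s -> (forall y, 0 < pi y) -> 0 < e ->
  (forall z, z \in s -> \sum_(y <- s) pi y * Q y z <= 0) ->
  \forall h \near 0^'+, forall z, z \in s ->
    \sum_(y <- s) pi y * kernel h y z <= (1 + e * h) * pi z.
Proof.
move=> us pi0 e0 piQ; apply: near_all_seq => z zs.
have cv : \sum_(y <- s) pi y * ((kernel h y z - (y == z)%:R) / h) @[h --> 0^'+] -->
    \sum_(y <- s) pi y * Q y z.
  apply: cvg_sumr_seq => y; apply: cvgMr; exact: (cvg_kernel_rate MX).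
have lt_e : \sum_(y <- s) pi y * Q y z < e * pi z.
  by rewrite (le_lt_trans (piQ _ zs))// mulr_gt0.
have near_lt : \forall h \near 0^'+,
    \sum_(y <- s) pi y * ((kernel h y z - (y == z)%:R) / h) < e * pi z.
  exact: cvgr_lt cv _ lt_e.
apply: filterS2 (nbhs_right_gt (0 : R)) near_lt => h h0.
under eq_bigr do rewrite mulrA; rewrite -mulr_suml ltr_pdivrMr//.
under eq_bigr do rewrite mulrBr; rewrite sumrB [X in _ - X](_ : _ = pi z).
  by rewrite ltrBlDr => /ltW; congr (_ <= _); ring.
rewrite (bigD1_seq z)//= eqxx mulr1 big1 ?addr0// => y /negbTE ->.
by rewrite mulr0.
Qed.

(** Each finite partial sum is bounded by [expR (e * t) * pi z] for every [e > 0], and then [e]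
    tends to 0. *)
Lemma subinvariant_kernel (pi : S -> R) (t : R) (z : S) :
  (forall y, 0 < pi y) ->
  (forall (s : seq S) u, uniq s -> u \in s -> \sum_(y <- s) pi y * Q y u <= 0) ->
  0 <= t ->
  (\esum_(y in [set: S]) (pi y * kernel t y z)%:E <= (pi z)%:E)%E.
Proof.
move=> pi0 piQ; rewrite le_eqVlt => /predU1P[<-|t0].
  rewrite (@esum_seq _ _ [:: z])//= => [|y|y].
  - by rewrite big_seq1 (kernel0 MX) eqxx mulr1.
  - by rewrite lee_fin mulr_ge0 ?kernel_ge0// ltW.
  - by rewrite inE (kernel0 MX) => /negbTE ->; rewrite mulr0.
have mX A : measurable (X t @^-1` A) by apply: (markov_measurable MX); exact: ltW.
apply: esum_le_seq => r ur.
have bound e : 0 < e ->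
    (\sum_(y <- r) (pi y)%:E * Pr y (X t @^-1` [set z]) <= (expR (e * t) * pi z)%:E)%E.
  move=> e0.
  (* All the grids are constrained at once, because the step will be chosen after [m] and depending
     on it. *)
  pose B m := \bigcap_n confined (enum_below m) (t / n.+1%:R) n.+1.
  have h_ge0 n : 0 <= t / n.+1%:R by rewrite divr_ge0// ltW.
  have mB m : measurable (B m `&` X t @^-1` [set z]).
    apply: measurableI => //; apply: bigcap_measurableType => n _.
    exact: measurable_confined.
  have cvgB y : Pr y (B m `&` X t @^-1` [set z]) @[m --> \oo] -->
      Pr y (X t @^-1` [set z]).
    (* Every path belongs to some [B m], its range on [[0, t]] being finite. *)
    have BE : X t @^-1` [set z] = \bigcup_m (B m `&` X t @^-1` [set z]).
      apply/seteqP; split=> [w wz|w [m _ []//]].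
      have [m hm] := path_range_finite w t.
      exists m => //; split=> // n _; apply/confinedP => j jn; apply: hm.
      rewrite mulrn_wge0//= (le_trans (ler_wpMn2l (h_ge0 n) jn))//.
      by rewrite -(mulr_natr (t / n.+1%:R)) divfK.
    rewrite {2}BE; apply: (@nondecreasing_cvg_mu _ _ _ (Pr y)) => //.
      by rewrite -BE.
    move=> m1 m2 m12; apply/subsetPset; apply: setSI => w Bw n _.
    apply/confinedP => j jn; have /confinedP/(_ j jn) := Bw n Logic.I.
    by rewrite !mem_enum_below => /leq_trans; exact.
  have cvgS : (\sum_(y <- r) (pi y)%:E * Pr y (B m `&` X t @^-1` [set z]))%E
      @[m --> \oo] --> (\sum_(y <- r) (pi y)%:E * Pr y (X t @^-1` [set z]))%E.
    apply: cvg_nnesum => [y _|y _].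
      by apply: nearW => m; rewrite mule_ge0// lee_fin ltW.
    exact: cvgeZl.
  apply: (cvge_to_le cvgS); near=> m.
  have us := @enum_below_uniq S m; set s := enum_below m in us.
  have zs : z \in s by rewrite mem_enum_below; near: m; exact: nbhs_infty_gt.
  have rs : {subset r <= s}.
    move=> y; rewrite mem_enum_below; move: y; near: m.
    by apply: near_all_seq => y _; exact: nbhs_infty_gt.
  have := near_subinvariant us pi0 e0 (piQ s ^~ us).
  move=> /(near0_fraction t0)[n hn].
  have := confined_subinvariant n.+1 (h_ge0 n) (mulr_ge0 (ltW e0) (h_ge0 n)) us
    (fun y => ltW (pi0 y)) hn zs.
  have -> : t / n.+1%:R *+ n.+1 = t by rewrite -(mulr_natr (t / n.+1%:R)) divfK.
  (* Enlarge [r] to [s], then forget all the grids except the one of step [t / n.+1]. *)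
  move=> le1; apply: (@le_trans _ _ (\sum_(y <- s) (pi y)%:E *
      Pr y (confined s (t / n.+1%:R) n.+1 `&` X t @^-1` [set z]))%E).
    apply: (@le_trans _ _ (\sum_(y <- s) (pi y)%:E * Pr y (B m `&` X t @^-1` [set z]))%E).
      apply: sume_seq_subset => // y; by rewrite mule_ge0// lee_fin ltW.
    apply: lee_sum => y _; rewrite lee_pmul2l ?lte_fin//.
    apply: le_measure; rewrite ?inE//.
      by apply: measurableI => //; exact: measurable_confined.
    by apply: setSI => w; exact.
  apply: (le_trans le1); rewrite lee_fin; apply: ler_wpM2r; first exact: ltW.
  (* The bound [1 + a <= expR a] with [a = e * (t / n.+1%:R)], raised to the power [n.+1]. *)
  have -> : e * t = n.+1%:R * (e * (t / n.+1%:R)).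
    by rewrite mulrCA [_ * (t / _)]mulrC divfK.
  rewrite expRM_natl; apply: lerXn2r; last exact: expR_ge1Dx.
    by rewrite nnegrE addr_ge0// mulr_ge0// ltW.
  by rewrite nnegrE expR_ge0.
under eq_bigr do rewrite EFinM -(kernelE MX _ _ (ltW t0)).
apply/lee_addgt0Pr => e e0.
have e1 : 1 < 1 + e / pi z by rewrite ltrDl divr_gt0.
(* With this exponent the bound becomes exactly [pi z + e]. *)
have := bound (ln (1 + e / pi z) / t) (divr_gt0 (ln_gt0 e1) t0).
by rewrite divfK ?gt_eqF// lnK ?posrE ?(lt_trans _ e1)// mulrDl mul1r divfK ?gt_eqF.
Unshelve. all: by end_near. Qed.

End SubInvariance.

(** * Invariance and mean return times *)

Section Invariance.
Context {R : realType} {S : countType} {d : measure_display}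
  {Omega : measurableType d}.
Variables (X : R -> Omega -> S) (Pr : S -> probability Omega R) (Q : S -> S -> R).
Hypothesis MX : is_markov_process X Pr Q.
Variable pi : S -> R.
Hypothesis pi_gt0 : forall y, 0 < pi y.
Hypothesis pi_sum1 : (\esum_(y in [set: S]) (pi y)%:E = 1)%E.

Local Notation kernel := (kernel X Pr).

(** By [subinvariant_kernel] the left side is at most [pi z] for every [z]. Exchanging the sums
    shows that both sides have the same finite total over [z], so [le_esum_eq] applies. *)
Lemma kernel_invariant (t : R) (z : S) :
  (forall (s : seq S) u, uniq s -> u \in s -> \sum_(y <- s) pi y * Q y u <= 0) ->
  0 <= t -> (\esum_(y in [set: S]) (pi y * kernel t y z)%:E = (pi z)%:E)%E.
Proof.
move=> piQ t0.
have le_pi u := subinvariant_kernel MX u pi_gt0 piQ t0.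
have ge0 y u : 0 <= pi y * kernel t y u by rewrite mulr_ge0 ?kernel_ge0// ltW.
pose a u := fine (\esum_(y in [set: S]) (pi y * kernel t y u)%:E)%E.
have aE u : (\esum_(y in [set: S]) (pi y * kernel t y u)%:E = (a u)%:E)%E.
  rewrite fineK// ge0_fin_numE ?(le_lt_trans (le_pi u)) ?ltry//.
  by apply: esum_ge0 => y _; rewrite lee_fin.
rewrite aE; congr _%:E; apply: le_esum_eq; last by rewrite pi_sum1 ltry.
- by move=> u; rewrite -lee_fin -aE esum_ge0// => y _; rewrite lee_fin.
- by move=> u; rewrite -lee_fin -aE.
- under eq_esum do rewrite -aE; rewrite esum_exchange => [|i j]; last by rewrite lee_fin.
  apply: eq_esum => y _; under eq_esum do rewrite EFinM.
  by rewrite esumZl ?(kernel_sum1 MX)// ?mule1// => [|u]; rewrite ?lee_fin ?kernel_ge0 ?ltW.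
Qed.

Hypothesis pi_inv : forall t z, 0 <= t ->
  (\esum_(y in [set: S]) (pi y * kernel t y z)%:E = (pi z)%:E)%E.

Lemma kernel_invariant_for : invariant_for (transition X Pr) pi.
Proof.
move=> t A t0; rewrite /mass_measure.
under eq_esum => x _.
  rewrite (transition_esum MX)// -esumZl; [|exact: ltW|by move=> y; rewrite lee_fin kernel_ge0].
  under eq_esum do rewrite -EFinM.
  over.
rewrite esum_exchange; last by move=> x y; rewrite lee_fin mulr_ge0 ?kernel_ge0// ltW.
by apply: eq_esum => y _; exact: pi_inv.
Qed.

(** [pi x * kernel t x y] is a single term of the sum that equals [pi y]. *)
Lemma kernel_le_pi (t : R) (x y : S) : 0 <= t -> kernel t x y <= pi y / pi x.
Proof.
move=> t0; rewrite ler_pdivlMr// mulrC -lee_fin -(pi_inv y t0).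
apply: (@le_esum1 _ _ _ (fun x => (pi x * kernel t x y)%:E)) => // u.
by rewrite lee_fin mulr_ge0 ?kernel_ge0// ltW.
Qed.

Lemma kernel_diag_lt1 (t : R) (x y : S) : 0 <= t -> x != y -> 0 < kernel t x y ->
  kernel t x x < 1.
Proof.
move=> t0 xy kxy; have kge0 u : (0 <= (kernel t x u)%:E)%E by rewrite lee_fin kernel_ge0.
have := @seq_le_esum _ _ (fun u => (kernel t x u)%:E) [:: x; y] kge0.
rewrite /= inE xy /= (kernel_sum1 MX)// !big_cons big_nil adde0 -EFinD lee_fin.
by move=> /(_ isT); apply: lt_le_trans; rewrite ltrDl.
Qed.

(** An initial stay at [x] is allowed, as in [return_time]. The default value [x] of [nth] is never
    read, both indices being below [size p]. *)
Let no_return_seq (x : S) : set (seq S) :=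
  [set p | forall i j, (i <= j < size p)%N -> nth x p i <> x -> nth x p j <> x].

Definition no_return (x : S) (n : nat) : set Omega :=
  sample X (grid 1 n) @^-1` no_return_seq x.

Lemma no_returnP (x : S) (n : nat) (w : Omega) :
  no_return x n w <->
  forall i j, (i <= j <= n)%N -> X i%:R w <> x -> X j%:R w <> x.
Proof.
have nthE i : (i <= n)%N -> nth x (sample X (grid 1 n) w) i = X i%:R w.
  move=> lin; rewrite /sample (nth_map 0) ?size_map ?size_iota// (nth_map 0%N) ?size_iota//.
  by rewrite nth_iota.
split=> H i j /andP[ij jn].
  by have := H i j; rewrite !size_map size_iota ltnS ij jn !nthE ?(leq_trans ij)//; exact.
move: jn; rewrite !size_map size_iota ltnS => jn.
by rewrite !nthE ?(leq_trans ij)//; apply: H; rewrite ij.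
Qed.

Lemma measurable_no_return (x : S) (n : nat) : measurable (no_return x n).
Proof. by apply: (measurable_sample_event MX) => u /(grid_bound ler01)/andP[]. Qed.

Let mX (t : R) A : 0 <= t -> measurable (X t @^-1` A).
Proof. by move=> t0; exact: (markov_measurable MX). Qed.

(** Summed over [n], this is the Green function of the unit-time skeleton started at [x] and killed
    at its return. *)
Let r (x : S) (n : nat) (z : S) : R := fine (Pr x (no_return x n `&` X n%:R @^-1` [set z])).

Let rE (x : S) (n : nat) (z : S) :
  Pr x (no_return x n `&` X n%:R @^-1` [set z]) = (r x n z)%:E.
Proof.
rewrite fineK// fin_num_measure//; apply: measurableI.
  exact: measurable_no_return.
exact: mX.
Qed.

Let r_ge0 (x : S) (n : nat) (z : S) : 0 <= r x n z.
Proof. by rewrite fine_ge0. Qed.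

Let r0 (x z : S) : r x 0 z <= (x == z)%:R.
Proof.
rewrite -(kernel0 MX) -lee_fin -rE -(kernelE MX)//; apply: le_measure; rewrite ?inE//.
  by apply: measurableI; [exact: measurable_no_return|exact: mX].
exact: mX.
Qed.

Let rS (x : S) (n : nat) (z : S) :
  ((r x n.+1 z)%:E <= \esum_(y in [set: S]) (r x n y * kernel 1 y z)%:E)%E.
Proof.
have := markov_property_sum MX x (no_return_seq x) z (ler0n R n) ler01
  (grid_bound ler01).
rewrite -/(no_return x n); under eq_esum do rewrite rE -EFinM; move=> <-.
rewrite -rE -natr1; apply: le_measure; rewrite ?inE.
- by apply: measurableI; [exact: measurable_no_return|exact: mX].
- by apply: measurableI; [exact: measurable_no_return|apply: mX; rewrite addr_ge0].
- apply: setSI => w /no_returnP H; apply/no_returnP => i j /andP[ij jn].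
  by apply: H; rewrite ij leqW.
Qed.

(** Being at [x] at time [n.+1] without a return forces being at [x] at time [n] already, so a
    single term of the sum in [rS] survives. *)
Let rS_diag (x : S) (n : nat) : r x n.+1 x <= r x n x * kernel 1 x x.
Proof.
have := markov_property_sample MX x (no_return_seq x) x x (ler0n R n) ler01
  (grid_bound ler01).
rewrite -/(no_return x n) rE -EFinM -lee_fin => <-.
rewrite -rE -natr1; apply: le_measure; rewrite ?inE.
- by apply: measurableI; [exact: measurable_no_return|exact: mX].
- apply: measurableI; last by apply: mX; rewrite addr_ge0.
  by apply: measurableI; [exact: measurable_no_return|exact: mX].
- move=> w [/no_returnP H wx]; split=> //; split=> /=.
    by apply/no_returnP => i j /andP[ij jn]; apply: H; rewrite ij leqW.
  apply: contrapT => Xn; apply: (H n n.+1 _ Xn); first by rewrite leqnSn leqnn.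
  by rewrite -natr1.
Qed.

(** The return time is at most the first integer at which the skeleton has returned, and the mean of
    that integer is the sum of the probabilities of [no_return x n]. *)
Lemma mean_return_time_lty (x : S) : kernel 1 x x < 1 ->
  (\int[Pr x]_w return_time X x w < +oo)%E.
Proof.
move=> k1; set k := kernel 1 x x in k1.
have k0 : 0 <= k by exact: kernel_ge0.
have k10 : 0 < 1 - k by rewrite subr_gt0.
(* The solution of [c * pi x = 1 + c * pi x * k], which closes the induction of [green] at [z = x];
   at the other states invariance of [pi] closes it. *)
pose c := ((1 - k) * pi x)^-1.
have c0 : 0 < c by rewrite invr_gt0 mulr_gt0.
have green N z : \sum_(n < N) r x n z <= c * pi z.
  elim: N z => [|N IH] z; first by rewrite big_ord0 mulr_ge0// ltW.
  rewrite big_ord_recl /=; under eq_bigr do rewrite /bump leq0n add1n.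
  have [<-|xz] := eqVneq x z.
    apply: (@le_trans _ _ (1 + (c * pi x) * k)).
      apply: lerD; first by rewrite (le_trans (r0 x x))// eqxx.
      apply: (@le_trans _ _ (\sum_(n < N) r x n x * k)).
        by apply: ler_sum => n _; exact: rS_diag.
      by rewrite -mulr_suml ler_wpM2r.
    rewrite le_eqVlt; apply/orP; left; apply/eqP; rewrite /c.
    by field; rewrite !gt_eqF.
  have /eqP -> : r x 0 z == 0 by rewrite eq_le r_ge0 andbT (le_trans (r0 x z))// (negbTE xz).
  rewrite add0r -lee_fin -sumEFin.
  apply: (@le_trans _ _
      (\sum_(n < N) \esum_(y in [set: S]) (r x n y * kernel 1 y z)%:E)%E).
    by apply: lee_sum => n _; exact: rS.
  rewrite -esum_sum => [|y n _ _]; last by rewrite lee_fin mulr_ge0 ?kernel_ge0.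
  apply: (@le_trans _ _ (\esum_(y in [set: S]) (c%:E * (pi y * kernel 1 y z)%:E))%E).
    apply: le_esum => y _; rewrite sumEFin lee_fin -mulr_suml mulrA.
    by rewrite ler_wpM2r ?kernel_ge0.
  rewrite esumZl ?pi_inv ?EFinM ?(ltW c0)// => y.
  by rewrite lee_fin mulr_ge0 ?kernel_ge0// ltW.
have fibers n : Pr x (no_return x n) = (\esum_(z in [set: S]) (r x n z)%:E)%E.
  rewrite -[in LHS](setIT (no_return x n)) -(preimage_setT (X n%:R)).
  rewrite measure_fibers => [|//|z]; last exact: mX.
    by apply: eq_esum => z _; exact: rE.
  exact: measurable_no_return.
have sumP N : (\sum_(n < N) Pr x (no_return x n) <= c%:E)%E.
  under eq_bigr do rewrite fibers.
  rewrite -esum_sum => [|y n _ _]; last by rewrite lee_fin.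
  apply: (@le_trans _ _ (\esum_(y in [set: S]) (c%:E * (pi y)%:E))%E).
    by apply: le_esum => y _; rewrite sumEFin -EFinM lee_fin; exact: green.
  by rewrite esumZl ?pi_sum1 ?mule1 ?(ltW c0)// => y; rewrite lee_fin ltW.
(* The events [no_return x n] decrease with [n], so [g] is the first [n] at which the skeleton has
   returned, and [+oo] if there is none. *)
pose g w : \bar R := (\sum_(0 <= n <oo) (\1_(no_return x n) w)%:E)%E.
apply: (@le_lt_trans _ _ (\int[Pr x]_w g w)%E).
  apply: ge0_le_integral_gen => w.
    by apply: le_ereal_inf_tmp => _ [t [s [s0 st _ _]] <-]; rewrite lee_fin (le_trans s0).
  have [[n nw]|nw] := pselect (exists n, ~ no_return x n w); last first.
    rewrite (_ : g w = +oo%E) ?leey//; apply/eqyP => A A0.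
    pose N := (Num.truncn A).+1.
    apply: (@le_trans _ _ (\sum_(0 <= n < N) (\1_(no_return x n) w)%:E)%E); last first.
      by apply: nneseries_lim_ge => l _; rewrite lee_fin.
    rewrite big_mkord sumEFin lee_fin.
    rewrite (eq_bigr (fun=> 1)) ?sumr_const ?card_ord => [|l _]; last first.
      by rewrite indicE mem_set//; apply: contrapT => nk; apply: nw; exists l.
    exact/ltW/truncnS_gt.
  pose P n := `[< ~ no_return x n w >].
  have exP : exists n, P n by exists n; apply/asboolP.
  case: (ex_minnP exP) => m /asboolP Pm minm.
  apply: (@le_trans _ _ m%:R%:E).
    (* Failure at [m] yields integers [i <= j <= m] with the path away from [x] at [i] and at [x] at
       [j]; hence [j] bounds the return time. *)
    move: Pm; rewrite no_returnP => /existsNP[i /existsNP[j]].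
    move=> /not_implyP[/andP[ij jm]] /not_implyP[Xi /contrapT Xj].
    apply: (@le_trans _ _ j%:R%:E); last by rewrite lee_fin ler_nat.
    apply: ereal_inf_lbound; exists j%:R => //; exists i%:R; split=> //.
    by rewrite ler_nat.
  apply: (@le_trans _ _ (\sum_(0 <= n < m) (\1_(no_return x n) w)%:E)%E); last first.
    by apply: nneseries_lim_ge => l _; rewrite lee_fin.
  rewrite big_mkord sumEFin lee_fin -[X in X%:R]card_ord -sumr_const.
  apply: ler_sum => l _; rewrite indicE mem_set//.
  apply: contrapT => nk; have := minm l; rewrite leqNgt ltn_ord => H.
  by apply: notF; apply: H; apply/asboolP.
rewrite integral_nneseries//; last first.
  by move=> n; exact/measurable_EFinP/measurable_indic/measurable_no_return.
apply: (@le_lt_trans _ _ c%:E); last exact: ltry.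
apply: lime_le.
  by apply: is_cvg_nneseries => n _ _; apply: integral_ge0 => w _; rewrite lee_fin.
apply: nearW => N; rewrite big_mkord; apply: le_trans (sumP N).
by apply: lee_sum => n _; rewrite integral_indic ?setIT//; exact: measurable_no_return.
Qed.

End Invariance.

(** * Convergence in total variation *)

Section Convergence.
Context {R : realType} {S : countType} {d : measure_display}
  {Omega : measurableType d}.
Variables (X : R -> Omega -> S) (Pr : S -> probability Omega R) (Q : S -> S -> R).
Hypothesis MX : is_markov_process X Pr Q.
Variable pi : S -> R.
Hypothesis pi_gt0 : forall y, 0 < pi y.
Hypothesis pi_sum1 : (\esum_(y in [set: S]) (pi y)%:E = 1)%E.

Local Notation kernel := (kernel X Pr).

Hypothesis pi_inv : forall t z, 0 <= t ->
  (\esum_(y in [set: S]) (pi y * kernel t y z)%:E = (pi z)%:E)%E.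
Hypothesis kernel_gt0 : forall t x y, 0 < t -> 0 < kernel t x y.

Variable x : S.

Definition surplus (t : R) (y : S) : R := Num.max 0 (kernel t x y - pi y).
Definition deficit (t : R) (y : S) : R := Num.max 0 (pi y - kernel t x y).

Lemma surplus_ge0 (t : R) (y : S) : 0 <= surplus t y.
Proof. by rewrite le_max lexx. Qed.

Lemma deficit_ge0 (t : R) (y : S) : 0 <= deficit t y.
Proof. by rewrite le_max lexx. Qed.

(** Written with additions only, so that it can be summed over nonnegative families without
    subtracting extended reals. *)
Lemma surplus_deficit (t : R) (y : S) :
  kernel t x y + deficit t y = pi y + surplus t y.
Proof.
by rewrite /surplus /deficit /Num.max; case: ltP => ? /=; case: ltP => ? /=; lra.
Qed.

(** From [kernel_le_pi]. The constant does not depend on [t], so the tails of the surplus are small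
    uniformly in time. *)
Lemma surplus_le (t : R) (y : S) : 0 <= t -> surplus t y <= (1 + (pi x)^-1) * pi y.
Proof.
move=> t0; have /= := kernel_le_pi pi_gt0 pi_inv x y t0.
have := pi_gt0 y; have : 0 < pi y / pi x by rewrite divr_gt0.
by rewrite ge_max mulrDl mul1r [_^-1 * _]mulrC => ? ? ?; apply/andP; split; lra.
Qed.

Lemma deficit_le (t : R) (y : S) : deficit t y <= (1 + (pi x)^-1) * pi y.
Proof.
have := pi_gt0 y; have : 0 < pi y / pi x by rewrite divr_gt0.
have := kernel_ge0 X Pr t x y.
by rewrite ge_max mulrDl mul1r [_^-1 * _]mulrC => ? ? ?; apply/andP; split; lra.
Qed.

Definition excess (t : R) : R := fine (\esum_(y in [set: S]) (surplus t y)%:E)%E.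

Lemma excessE (t : R) : 0 <= t ->
  (\esum_(y in [set: S]) (surplus t y)%:E = (excess t)%:E)%E.
Proof.
move=> t0; rewrite fineK// ge0_fin_numE.
  apply: (@le_lt_trans _ _ 1%E); rewrite ?ltry// -(kernel_sum1 MX x t0).
  apply: le_esum => y _; rewrite lee_fin ge_max kernel_ge0/=.
  by rewrite gerBl ltW.
by apply: esum_ge0 => y _; rewrite lee_fin surplus_ge0.
Qed.

Lemma excess_ge0 (t : R) : 0 <= excess t.
Proof. by rewrite fine_ge0// esum_ge0// => y _; rewrite lee_fin surplus_ge0. Qed.

(** [kernel t x] and [pi] both have mass 1, so the positive and negative parts of their difference
    have equal masses. *)
Lemma excess_deficit (t : R) : 0 <= t ->
  (\esum_(y in [set: S]) (deficit t y)%:E = (excess t)%:E)%E.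
Proof.
move=> t0.
have : (1 + \esum_(y in [set: S]) (deficit t y)%:E = 1 + (excess t)%:E)%E.
  rewrite -{1}(kernel_sum1 MX x t0) -pi_sum1 -excessE// -!esumD => [||||]; last first.
  all: try by move=> y _; rewrite lee_fin ?kernel_ge0 ?deficit_ge0 ?surplus_ge0 ?ltW.
  by apply: eq_esum => y _; rewrite -!EFinD surplus_deficit.
by case: (\esum_(y in _) _)%E => [r||]//= [] /addrI ->.
Qed.

(** The kernel of time [s] carries surplus and deficit to two measures whose difference is the new
    signed measure. At [z0] both of them are at least [m], and this common mass cancels. *)
Lemma excess_step (t s : R) (z0 : S) (m : R) : 0 <= t -> 0 <= s -> 0 <= m ->
  (m%:E <= \esum_(y in [set: S]) (surplus t y * kernel s y z0)%:E)%E ->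
  (m%:E <= \esum_(y in [set: S]) (deficit t y * kernel s y z0)%:E)%E ->
  excess (t + s) + m <= excess t.
Proof.
move=> t0 s0 m0.
have k_ge0 := kernel_ge0 X Pr.
pose C := 1 + (pi x)^-1.
have C0 : 0 <= C by rewrite addr_ge0// invr_ge0 ltW.
(* Finiteness comes from the domination by [C * pi] and the invariance of [pi]. *)
have fin f z : (forall y, 0 <= f y <= C * pi y) ->
    (\esum_(y in [set: S]) (f y * kernel s y z)%:E)%E \is a fin_num.
  move=> hf; have f0 y : 0 <= f y by case/andP: (hf y).
  rewrite ge0_fin_numE ?esum_ge0// => [|y _]; last by rewrite lee_fin mulr_ge0.
  apply: (@le_lt_trans _ _ (C%:E * (pi z)%:E)%E); last by rewrite -EFinM ltry.
  rewrite -(pi_inv z s0) -esumZl// => [|y]; last by rewrite lee_fin mulr_ge0// ltW.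
  by apply: le_esum => y _; rewrite lee_fin mulrA ler_wpM2r//; case/andP: (hf y).
have [aK aKE] : exists aK : S -> R, forall z,
    (\esum_(y in [set: S]) (surplus t y * kernel s y z)%:E = (aK z)%:E)%E.
  eexists => z; rewrite -[LHS]fineK; first reflexivity.
  by apply: fin => y; rewrite surplus_ge0 surplus_le.
have [bK bKE] : exists bK : S -> R, forall z,
    (\esum_(y in [set: S]) (deficit t y * kernel s y z)%:E = (bK z)%:E)%E.
  eexists => z; rewrite -[LHS]fineK; first reflexivity.
  by apply: fin => y; rewrite deficit_ge0 deficit_le.
have aK0 z : 0 <= aK z.
  by rewrite -lee_fin -aKE esum_ge0// => y _; rewrite lee_fin mulr_ge0// surplus_ge0.
have bK0 z : 0 <= bK z.
  by rewrite -lee_fin -bKE esum_ge0// => y _; rewrite lee_fin mulr_ge0// deficit_ge0.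
have diff z : kernel (t + s) x z + bK z = pi z + aK z.
  apply: EFin_inj; rewrite !EFinD -aKE -bKE (kernelD MX)// -(pi_inv z s0).
  rewrite -!esumD => [||||]; last first.
  all: try by move=> y _; rewrite lee_fin mulr_ge0 ?deficit_ge0 ?surplus_ge0// ltW.
  by apply: eq_esum => y _; rewrite -!EFinD -!mulrDl surplus_deficit.
rewrite aKE bKE !lee_fin => ma mb.
rewrite -lee_fin EFinD -!excessE ?addr_ge0//.
(* The constant [m] becomes a point mass at [z0], which allows a termwise comparison. *)
have -> : (m%:E = \esum_(z in [set: S]) ((z == z0)%:R * m)%:E)%E.
  rewrite (@esum_seq _ _ [:: z0])//= ?big_seq1 ?eqxx ?mul1r// => [z|z].
    by rewrite lee_fin mulr_ge0.
  by rewrite inE => /negbTE ->; rewrite mul0r.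
rewrite -esumD => [|z _|z _]; rewrite ?lee_fin ?surplus_ge0 ?mulr_ge0//.
(* The transported surplus keeps its total mass, since the rows of the kernel sum to 1. *)
have -> : (\esum_(y in [set: S]) (surplus t y)%:E = \esum_(z in [set: S]) (aK z)%:E)%E.
  under [RHS]eq_esum do rewrite -aKE.
  rewrite esum_exchange => [|y z]; last by rewrite lee_fin mulr_ge0 ?surplus_ge0.
  apply: eq_esum => y _; under eq_esum do rewrite EFinM.
  rewrite esumZl ?surplus_ge0//; last by move=> u; rewrite lee_fin.
  by rewrite (kernel_sum1 MX)// mule1.
apply: le_esum => z _; rewrite -EFinD lee_fin /surplus /Num.max.
have := diff z; have := aK0 z; have := bK0 z.
by have [->|] := eqVneq z z0; rewrite ?mul1r ?mul0r; case: ltP; lra.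
Qed.

Lemma excess_nonincreasing (t s : R) : 0 <= t <= s -> excess s <= excess t.
Proof.
case/andP=> t0 ts; have st : 0 <= s - t by rewrite subr_ge0.
have := @excess_step t (s - t) x 0 t0 st (lexx 0).
rewrite subrKC addr0; apply; apply: esum_ge0 => y _.
  by rewrite lee_fin mulr_ge0 ?surplus_ge0 ?kernel_ge0.
by rewrite lee_fin mulr_ge0 ?deficit_ge0 ?kernel_ge0.
Qed.

(** A minorization on a finite set: part of the surplus and part of the deficit reach the same state
    [x] within one unit of time, where [excess_step] cancels them. *)
Lemma excess_drop (e : R) : 0 < e -> exists2 m, 0 < m &
  forall t, 0 <= t -> e <= excess t -> excess (t + 1) + m <= excess t.
Proof.
move=> e0; pose C := 1 + (pi x)^-1.
have C0 : 0 < C by rewrite addr_gt0// invr_gt0.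
(* Outside [s], [pi] has mass at most [e / (2 * C)], so surplus and deficit have mass at most
   [e / 2] there. *)
have [s us hs] := esum_tail (fun y => ltW (pi_gt0 y)) pi_sum1
  (divr_gt0 e0 (mulr_gt0 (ltr0n _ 2) C0) : 0 < e / (2 * C)).
have [k k0 ks] := seq_lower_bound s (fun y => kernel_gt0 y x ltr01).
exists (k * (e / 2)); first by rewrite mulr_gt0// divr_gt0.
move=> t t0 et.
have main f : (forall y, 0 <= f y <= C * pi y) ->
    (\esum_(y in [set: S]) (f y)%:E = (excess t)%:E)%E ->
    ((k * (e / 2))%:E <= \esum_(y in [set: S]) (f y * kernel 1 y x)%:E)%E.
  move=> hf fe; have f0 y : 0 <= f y by case/andP: (hf y).
  have fC y : f y <= C * pi y by case/andP: (hf y).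
  apply: (@le_trans _ _ (\sum_(y <- s) (f y * kernel 1 y x)%:E)%E); last first.
    apply: (@seq_le_esum _ _ (fun y => (f y * kernel 1 y x)%:E)) => // y.
    by rewrite lee_fin mulr_ge0// kernel_ge0.
  rewrite sumEFin lee_fin.
  apply: (@le_trans _ _ (\sum_(y <- s) f y * k)); last first.
    by rewrite big_seq [leRHS]big_seq ler_sum// => y /ks; apply: ler_wpM2l.
  rewrite -mulr_suml mulrC ler_wpM2r ?(ltW k0)//.
  have split_sum (g : S -> R) : (forall y, 0 <= g y) ->
      (\esum_(y in [set: S]) (g y)%:E =
       (\sum_(y <- s) g y)%:E + \esum_(y in ~` [set` s]) (g y)%:E)%E.
    move=> g0; rewrite (esumID [set` s]) => [|y _]; last by rewrite lee_fin.
    rewrite !setTI -sumEFin fsbig_seq//; congr (_ + _)%E.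
    by apply: esum_fset => // y _; rewrite lee_fin.
  have := split_sum f f0; have := split_sum pi (fun y => ltW (pi_gt0 y)).
  rewrite pi_sum1 fe.
  set tp := esum _ (fun i => (pi i)%:E); set tf := esum _ _ => piE fE.
  have tfp : (tf <= C%:E * tp)%E.
    rewrite -esumZl ?(ltW C0)// => [|y]; last by rewrite lee_fin ltW.
    by apply: le_esum => y _; rewrite -EFinM lee_fin.
  have tp0 : (0 <= tp)%E by apply: esum_ge0 => y _; rewrite lee_fin ltW.
  have tf0 : (0 <= tf)%E by apply: esum_ge0 => y _; rewrite lee_fin.
  move: tp tf tp0 tf0 tfp piE fE => [tp||]//= [tf||]//=; rewrite ?lee_fin.
  move=> tp0 tf0 tfp [piE] [fE].
  have : C * tp <= e / 2.
    rewrite -ler_pdivlMl// (_ : C^-1 * (e / 2) = e / (2 * C)); last first.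
      by field; rewrite gt_eqF.
    lra.
  lra.
apply: (@excess_step _ _ x) => //.
- by rewrite mulr_ge0 ?(ltW k0)// divr_ge0// ltW.
- by apply: main; [move=> y; rewrite surplus_ge0 surplus_le|rewrite excessE].
- by apply: main; [move=> y; rewrite deficit_ge0 deficit_le|rewrite excess_deficit].
Qed.

(** If the excess were at least [e] at all integer times, it would drop by [m] each time and end up
    negative. Once below [e] it stays there by monotonicity. *)
Lemma excess_cvg0 : excess t @[t --> +oo] --> (0 : R).
Proof.
apply/cvgrPdist_lt => e e0.
have [m m0 drop] := excess_drop e0.
have [n en] : exists n : nat, excess n%:R < e.
  apply: contrapT => /forallNP H.
  have {}H n : e <= excess n%:R by rewrite leNgt; apply/negP.
  have le n : excess n%:R + n%:R * m <= excess 0.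
    elim: n => [|n IH]; first by rewrite mul0r addr0.
    apply: le_trans IH; have := drop n%:R (ler0n _ _) (H n).
    by rewrite -natr1; lra.
  have := le (Num.truncn (excess 0 / m)).+1; have := excess_ge0.
  move=> /(_ (Num.truncn (excess 0 / m)).+1%:R).
  have : excess 0 / m < (Num.truncn (excess 0 / m)).+1%:R by exact: truncnS_gt.
  by rewrite ltr_pdivrMr//; lra.
near=> t; rewrite sub0r normrN ger0_norm ?excess_ge0//.
apply: le_lt_trans en; apply: excess_nonincreasing; rewrite ler0n/=.
by near: t; exact: nbhs_pinfty_ge.
Unshelve. all: by end_near. Qed.

(** On each [A] the difference is the surplus of [A] minus its deficit, and both lie between 0 and
    the excess. *)
Lemma tv_norm_le_excess (t : R) : 0 <= t ->
  (tv_norm (fun A : set S => transition X Pr t x A - mass_measure pi A)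
    <= (excess t)%:E)%E.
Proof.
move=> t0; apply: ge_ereal_sup => _ [A _ <-].
rewrite (transition_esum MX)// /mass_measure.
have le_fin (f : S -> R) (c : R) : (forall y, 0 <= f y) ->
    (\esum_(y in [set: S]) (f y)%:E = c%:E)%E ->
    exists2 r, 0 <= r <= c & (\esum_(y in A) (f y)%:E = r%:E)%E.
  move=> f0 fc; have : (\esum_(y in A) (f y)%:E <= c%:E)%E.
    by rewrite -fc; exact: le_esum_subset.
  have : (0 <= \esum_(y in A) (f y)%:E)%E by apply: esum_ge0 => y _; rewrite lee_fin.
  case: (\esum_(y in A) _)%E => [r||]//; rewrite !lee_fin => r0 rc.
  by exists r; rewrite ?r0.
have [k _ kE] := le_fin _ _ (kernel_ge0 X Pr t x) (kernel_sum1 MX x t0).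
have [p _ pE] := le_fin _ _ (fun y => ltW (pi_gt0 y)) pi_sum1.
have [a /andP[a0 ae] aE] := le_fin _ _ (surplus_ge0 t) (excessE t0).
have [b /andP[b0 be] bE] := le_fin _ _ (deficit_ge0 t) (excess_deficit t0).
have : k + b = p + a.
  apply: EFin_inj; rewrite !EFinD -kE -bE -pE -aE -!esumD => [||||]; last first.
  all: try by move=> y _; rewrite lee_fin ?kernel_ge0 ?deficit_ge0 ?surplus_ge0 ?ltW.
  by apply: eq_esum => y _; rewrite -!EFinD surplus_deficit.
rewrite kE pE -EFinB abse_EFin lee_fin ler_norml => e.
by apply/andP; split; lra.
Qed.

Lemma tv_norm_cvg0 :
  tv_norm (fun A : set S => transition X Pr t x A - mass_measure pi A)%E
    @[t --> +oo] --> 0%E.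
Proof.
apply: (@squeeze_cvge _ _ _ _ (fun=> 0%E) _ (fun t => (excess t)%:E)).
- near=> t; rewrite tv_norm_le_excess ?andbT; last by near: t; exact: nbhs_pinfty_ge.
  apply: (@le_trans _ _ `|transition X Pr t x setT - mass_measure pi setT|%E).
    exact: abse_ge0.
  by apply: ereal_sup_ubound; exists setT.
- exact: cvg_cst.
- by apply: cvg_EFin; [exact: nearW|exact: excess_cvg0].
Unshelve. all: by end_near. Qed.

End Convergence.

(** * The queue *)

(** Splits the other states into those on level [n] and those off it, where only the vertical
    neighbours count. It serves both for the exit rate of a state and for the flow into it. *)
Lemma esum_queue_row {R : realType} (D : choiceType) (f : nat * D -> \bar R)
    (n : nat) (z : D) :
  (forall y, (0 <= f y)%E) ->
  (forall m w, m != n -> w != z -> f (m, w) = 0%E) ->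
  (forall m, m != n -> m != n.+1 -> m.+1 != n -> f (m, z) = 0%E) ->
  (\esum_(y in ~` [set (n, z)]) f y =
    f (n.+1, z) + (if n is m.+1 then f (m, z) else 0) +
    \esum_(w in ~` [set z]) f (n, w))%E.
Proof.
move=> f0 fdiag fjump; rewrite (esumID [set y | y.1 = n])// addeC; congr (_ + _)%E.
  rewrite esum_mkcond.
  pose s := (n.+1, z) :: (if n is m.+1 then [:: (m, z)] else [::]).
  have us : uniq s.
    rewrite /s; case: (n) => [|m]//=; rewrite inE andbT xpair_eqE eqxx andbT.
    by rewrite gtn_eqF.
  have sP y : (y \in s) = (y.2 == z) && ((y.1 == n.+1) || (y.1.+1 == n)).
    case: y => m w; rewrite /s; case: (n) => [|k] /=; rewrite !inE !xpair_eqE.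
      by rewrite orbF andbC.
    by rewrite eqSS -andb_orl andbC.
  rewrite (esum_seq us) => [|y|[m w]]; last 2 first.
  - by case: ifP.
  - rewrite sP /= => sN; case: ifP => // /[!inE] /= -[_ /eqP mn].
    move: sN; have [->|wz] := eqVneq w z; last by move=> _; exact: fdiag.
    by rewrite /= negb_or => /andP[? ?]; exact: fjump.
  rewrite /s big_cons ifT; last by rewrite inE /=; split=> [[/eqP]|/eqP]; rewrite gtn_eqF.
  case: (n) => [|m]; rewrite ?big_nil// big_seq1 ifT// inE /=.
  by split=> [[/eqP]|/eqP]; rewrite ltn_eqF.
rewrite (_ : _ `&` _ = (fun w => (n, w)) @` ~` [set z]); last first.
  apply/seteqP; split=> [[m w] [/= h mn]|_ [w /= wz <-]].
    by exists w; [move=> wz; apply: h; rewrite mn wz|rewrite mn].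
  by split=> // -[].
by rewrite esum_image// => u w _ _ [].
Qed.

Section Queue.
Context {R : realType} {D : countType}.
Variables (lambda mu : D -> R) (tau : nat -> D -> D -> R) (v : D -> R).
Hypothesis lambda_gt0 : forall z, 0 < lambda z.
Hypothesis mu_gt0 : forall z, 0 < mu z.
Hypothesis tau_gen : forall n, is_generator (tau n).
Hypothesis tau_irr : forall n, irreducible_generator (tau n).
Hypothesis v_ge0 : forall z, 0 <= v z.
Hypothesis v_neq0 : exists z, v z != 0.
Hypothesis v_balanced : balanced tau v.
Hypothesis rho_lt1 : forall z, rho lambda mu z < 1.
Hypothesis Xi_fin : (Xi lambda mu v < +oo)%E.

Local Notation rho := (rho lambda mu).
Local Notation Q := (queue_generator lambda mu tau).
Local Notation q := (queue_rate lambda mu tau).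
Local Notation Xi := (Xi lambda mu v).
Local Notation eta := (Defs.eta lambda mu v).
Local Notation pi := (queue_pi lambda mu v).

Lemma rho_gt0 (z : D) : 0 < rho z.
Proof. by rewrite divr_gt0. Qed.

Lemma queue_rate_ge0 (x y : nat * D) : 0 <= q x y.
Proof.
rewrite /queue_rate; case: eqVneq => [_|yx].
  by case: ifP => _; [exact: ltW|case: ifP => _ //; exact: ltW].
case: ifP => // _; rewrite mulr_ge0 ?invr_ge0 ?exprn_ge0 ?(ltW (rho_gt0 _))//.
by have [+ _] := tau_gen x.1; apply; rewrite eq_sym.
Qed.

(** If [v a = 0], balance makes the inflow into [a] vanish, so [v] vanishes at every state with a
    positive rate to [a]. By irreducibility a zero at [z] would spread back to a state where [v] is
    nonzero; level 0 is enough. *)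
Lemma balanced_gt0 (z : D) : 0 < v z.
Proof.
rewrite lt_neqAle v_ge0 andbT eq_sym; apply/eqP => vz0.
have [tau_ge0 _] := tau_gen 0.
have step x a : 0 < tau 0 x a -> v a = 0 -> v x = 0.
  move=> xa va; have [->//|neq_xa] := eqVneq x a.
  have := v_balanced 0 a; rewrite va mul0e => e.
  have : ((v x * tau 0 x a)%:E <= 0)%E.
    rewrite e esum_mkcond.
    have := @le_esum1 _ _ setT
      (fun i => if i \in ~` [set a] then (v i * tau 0 i a)%:E else 0%E) x.
    rewrite ifT; last by rewrite inE; exact/eqP.
    apply=> // i; case: ifP => // /[!inE] /= /eqP ia.
    by rewrite lee_fin mulr_ge0// tau_ge0.
  by rewrite lee_fin pmulr_lle0// => vx; apply/eqP; rewrite eq_le vx v_ge0.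
have [w /eqP] := v_neq0; apply.
have [p [wp wz]] := tau_irr 0 w z.
elim: p w wp wz => [w _ /= ->//|a p IH w /= /andP[wa ap] wz].
by apply: step wa _; exact: IH.
Qed.

Lemma queue_rate_up (n : nat) (z : D) : q (n, z) (n.+1, z) = lambda z.
Proof. by rewrite /queue_rate /= !eqxx. Qed.

Lemma queue_rate_down (n : nat) (z : D) : q (n.+1, z) (n, z) = mu z.
Proof. by rewrite /queue_rate /= !eqxx ltn_eqF. Qed.

Lemma queue_rate_env (n : nat) (z w : D) : w != z ->
  q (n, z) (n, w) = rho z ^- n * tau n z w.
Proof. by move=> /negbTE wz; rewrite /queue_rate /= wz eqxx. Qed.

Lemma queue_rate_diag (m n : nat) (z w : D) : m != n -> w != z ->
  q (n, z) (m, w) = 0.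
Proof. by move=> /negbTE mn /negbTE wz; rewrite /queue_rate /= wz mn. Qed.

Lemma queue_rate_jump (m n : nat) (z : D) : m != n.+1 -> m.+1 != n ->
  q (n, z) (m, z) = 0.
Proof.
move=> /negbTE mn; rewrite eq_sym => /negbTE nm.
by rewrite /queue_rate /= eqxx mn nm.
Qed.

Lemma queue_generatorE (x y : nat * D) : y != x -> Q x y = q x y.
Proof. by move=> /negbTE yx; rewrite /queue_generator /generator_of_rates yx. Qed.

Lemma queue_generator_diag (n : nat) (z : D) :
  Q (n, z) (n, z) =
  - (lambda z + (if n is _.+1 then mu z else 0) - rho z ^- n * tau n z z).
Proof.
have rho_inv : 0 <= rho z ^- n by rewrite invr_ge0 exprn_ge0// ltW// rho_gt0.
have [tau_ge0 tau_sum] := tau_gen n.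
rewrite /queue_generator /generator_of_rates eqxx esum_queue_row /=.
- rewrite queue_rate_up.
  have -> : (\esum_(w in ~` [set z]) (q (n, z) (n, w))%:E =
      (- (rho z ^- n * tau n z z))%:E)%E.
    rewrite -mulrN EFinM -tau_sum esum_mkcond [X in (_ * X)%E]esum_mkcond.
    rewrite -esumZl// => [|w].
      apply: eq_esum => w _; case: ifPn => [|_]; last by rewrite mule0.
      by rewrite inE /= => /eqP wz; rewrite queue_rate_env// EFinM.
    by case: ifPn => // /[!inE] /= /eqP wz; rewrite lee_fin tau_ge0// eq_sym.
  by case: (n) => [|m]; rewrite ?queue_rate_down -!EFinD.
- by move=> y; rewrite lee_fin queue_rate_ge0.
- by move=> m w mn wz; rewrite queue_rate_diag.
- by move=> m _ mn nm; rewrite queue_rate_jump.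
Qed.

(** Global balance. Between levels, [rho z * mu z = lambda z] gives detailed balance. Within a
    level, the factor [rho ^+ n] of [eta] cancels the factor [rho ^- n] of the rates, which leaves
    the balance equation of [v]. *)
Lemma eta_inflow (n : nat) (z : D) :
  (\esum_(y in ~` [set (n, z)]) (eta y * q y (n, z))%:E =
    (- (eta (n, z) * Q (n, z) (n, z)))%:E)%E.
Proof.
have [tau_ge0 tau_sum] := tau_gen n.
have rho_neq0 w : rho w != 0 by rewrite gt_eqF// rho_gt0.
have eta_ge0 y : 0 <= eta y by rewrite mulr_ge0// exprn_ge0// ltW// rho_gt0.
rewrite esum_queue_row.
- have -> : (\esum_(w in ~` [set z]) (eta (n, w) * q (n, w) (n, z))%:E =
      (- (v z * tau n z z))%:E)%E.
    rewrite -mulrN EFinM -tau_sum v_balanced; apply: eq_esum => w /= /eqP wz.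
    rewrite queue_rate_env; last by rewrite eq_sym.
    by rewrite /eta/= mulrCA mulrA mulKf// expf_neq0.
  have mulambda : rho z * mu z = lambda z by rewrite /Defs.rho divfK// gt_eqF.
  rewrite queue_generator_diag queue_rate_down /eta/=.
  case: n tau_sum {tau_ge0} => [|m] _; rewrite ?queue_rate_up -!EFinD; congr _%:E.
    by rewrite -mulambda; field.
  rewrite -mulambda !exprS; field.
  by rewrite expf_neq0 rho_neq0.
- by move=> y; rewrite lee_fin mulr_ge0 ?queue_rate_ge0.
- by move=> m w mn wz; rewrite queue_rate_diag ?mulr0// eq_sym.
- by move=> m _ mn nm; rewrite queue_rate_jump ?mulr0// eq_sym.
Qed.

Lemma Xi_gt0 : (0 < Xi)%E.
Proof.
have [z _] := v_neq0; apply: (@lt_le_trans _ _ (v z / (1 - rho z))%:E).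
  by rewrite lte_fin divr_gt0 ?balanced_gt0// subr_gt0.
apply: (@le_esum1 _ _ _ (fun z => (v z / (1 - rho z))%:E)) => // w.
by rewrite lee_fin divr_ge0// subr_ge0 ltW.
Qed.

Lemma fine_Xi_gt0 : 0 < fine Xi.
Proof. by rewrite fine_gt0// Xi_gt0. Qed.

(** After exchanging the sums, each [z] gives a geometric series of first term [v z] and ratio
    [rho z]. *)
Lemma XiE : Xi = (\sum_(0 <= n <oo) \esum_(z in [set: D]) (rho z ^+ n * v z)%:E)%E.
Proof.
have term_ge0 z n : (0 <= (rho z ^+ n * v z)%:E)%E.
  by rewrite lee_fin mulr_ge0// exprn_ge0// ltW// rho_gt0.
rewrite nneseries_esumT => [|n]; last exact: esum_ge0.
rewrite esum_exchange//; apply: eq_esum => z _; rewrite -nneseries_esumT//.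
have rho_norm : `|rho z| < 1 by rewrite gtr0_norm ?rho_gt0.
have gc := @cvg_geometric_series R (v z) _ rho_norm.
apply/esym/cvg_lim => //; apply: cvg_EFin.
  by apply: nearW => n; rewrite sumEFin.
apply: cvg_trans gc; apply: near_eq_cvg; apply: nearW => n /=.
by rewrite /series/= sumEFin; apply: eq_bigr => i _; rewrite mulrC.
Qed.

Lemma queue_pi_gt0 (x : nat * D) : 0 < pi x.
Proof.
by rewrite divr_gt0 ?fine_Xi_gt0// mulr_gt0 ?balanced_gt0// exprn_gt0// rho_gt0.
Qed.

Lemma queue_pi_sum1 : (\esum_(x in [set: nat * D]) (pi x)%:E = 1)%E.
Proof.
have eta_ge0 y : 0 <= eta y by rewrite mulr_ge0// exprn_ge0// ltW// rho_gt0.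
have etaE : (\esum_(x in [set: nat * D]) (eta x)%:E = Xi)%E.
  rewrite XiE nneseries_esumT => [|n]; last first.
    by apply: esum_ge0 => z _; rewrite lee_fin (eta_ge0 (n, z)).
  rewrite (esum_esum (a := fun n z => (rho z ^+ n * v z)%:E)) => [|n z _ _]; last first.
    by rewrite lee_fin (eta_ge0 (n, z)).
  by rewrite [X in _ = esum X _](_ : _ = setT)//; apply/seteqP; split.
under eq_esum do rewrite /queue_pi mulrC EFinM.
rewrite esumZl ?etaE ?invr_ge0 ?(ltW fine_Xi_gt0)// -(@fineK _ Xi).
  by rewrite -EFinM mulVf// gt_eqF// fine_Xi_gt0.
by rewrite ge0_fin_numE// ltW// Xi_gt0.
Qed.

(** The diagonal term is minus the total inflow of [eta_inflow], while a finite [s] retains only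
    part of that inflow. *)
Lemma queue_pi_subinvariant (s : seq (nat * D)) (x : nat * D) :
  uniq s -> x \in s -> \sum_(y <- s) pi y * Q y x <= 0.
Proof.
move=> us xs; under eq_bigr do rewrite /queue_pi mulrAC.
rewrite -mulr_suml mulr_le0_ge0 ?invr_ge0 ?(ltW fine_Xi_gt0)//.
rewrite (bigD1_seq x)//= -lerBrDl sub0r -lee_fin.
case: x xs => n z xs; rewrite -eta_inflow -big_filter -sumEFin.
have eta_ge0 y : 0 <= eta y by rewrite mulr_ge0// exprn_ge0// ltW// rho_gt0.
rewrite (eq_big_seq (fun y => (eta y * q y (n, z))%:E)) => [|y].
  rewrite esum_mkcond.
  apply: (@le_trans _ _ (\sum_(y <- [seq y <- s | y != (n, z)])
      (if y \in ~` [set (n, z)] then (eta y * q y (n, z))%:E else 0))%E).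
    rewrite big_seq [leRHS]big_seq; apply: lee_sum => y.
    by rewrite mem_filter => /andP[/eqP yx _]; rewrite ifT// inE.
  apply: seq_le_esum; rewrite ?filter_uniq// => y; case: ifP => // _.
  by rewrite lee_fin mulr_ge0 ?queue_rate_ge0.
by rewrite mem_filter => /andP[yx _]; rewrite queue_generatorE// eq_sym.
Qed.

Context {d : measure_display} {Omega : measurableType d}.
Variables (NZ : R -> Omega -> nat * D) (Pr : (nat * D)%type -> probability Omega R).
Hypothesis NZ_markov : is_markov_process NZ Pr Q.

(** From [(n, z)] to [(m, w)]: first change the environment on level [n], by irreducibility of
    [tau n], then move vertically by arrivals or services. *)
Lemma queue_kernel_gt0 (x y : nat * D) (t : R) : 0 < t -> 0 < kernel NZ Pr t x y.
Proof.
(* Positivity at every positive time is what composes through [kernel_gt0_trans]. *)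
pose reach x y := forall t, 0 < t -> 0 < kernel NZ Pr t x y.
have refl u : reach u u by move=> s /ltW; exact: (kernel_diag_gt0 NZ_markov).
have trans := kernel_gt0_trans NZ_markov : forall u w u', reach u w -> reach w u' -> reach u u'.
have rate u w : w != u -> 0 < q u w -> reach u w.
  by move=> wu quw; apply: (kernel_gt0_rate NZ_markov); rewrite queue_generatorE.
have level n z w : reach (n, z) (n, w).
  have [p [zp <-]] := tau_irr n z w.
  elim: p z zp => [z _ //|a p IH z /= /andP[za ap]].
  apply: trans (IH a ap).
  have [->//|az] := eqVneq a z.
  apply: rate; first by rewrite xpair_eqE eqxx.
  by rewrite queue_rate_env// mulr_gt0// invr_gt0 exprn_gt0// rho_gt0.
have up (n k : nat) z : reach (n, z) ((n + k)%N, z).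
  elim: k => [|k IH]; first by rewrite addn0.
  apply: trans IH _; rewrite addnS; apply: rate; last by rewrite queue_rate_up.
  by rewrite xpair_eqE eqxx andbT gtn_eqF.
have down (n k : nat) z : reach ((n + k)%N, z) (n, z).
  elim: k => [|k IH]; first by rewrite addn0.
  apply: trans IH; rewrite addnS; apply: rate; last by rewrite queue_rate_down.
  by rewrite xpair_eqE eqxx andbT ltn_eqF.
suff : reach x y by exact.
case: x y => [n z] [m w]; apply: trans (level n z w) _.
have [nm|/ltnW mn] := leqP n m; first by rewrite -(subnKC nm).
by rewrite -{1}(subnKC mn).
Qed.

End Queue.

Theorem theorem2p1 (R : realType) (D : countType)
  (lambda mu : D -> R)
  (lambda_gt0 : forall z, 0 < lambda z)
  (mu_gt0 : forall z, 0 < mu z)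
  (tau : nat -> D -> D -> R)
  (tau_gen : forall n, is_generator (tau n))
  (tau_irr : forall n, irreducible_generator (tau n))
  (d : measure_display) (Omega : measurableType d)
  (NZ : R -> Omega -> nat * D)
  (Pr : (nat * D)%type -> probability Omega R)
  (NZ_markov : is_markov_process NZ Pr (queue_generator lambda mu tau))
  (v : D -> R)
  (v_ge0 : forall z, 0 <= v z)
  (v_neq0 : exists z, v z != 0)
  (v_balanced : balanced tau v)
  (rho_lt1 : forall z, rho lambda mu z < 1)
  (Xi_fin : (Xi lambda mu v < +oo)%E) :
  let P := transition NZ Pr in
  let pi := queue_pi lambda mu v in
  (Xi lambda mu v =
     \sum_(0 <= n <oo) \esum_(z in [set: D]) (rho lambda mu z ^+ n * v z)%:E)%E
  /\ irreducible_kernel P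
  /\ aperiodic_kernel P
  /\ positive_recurrent NZ Pr
  /\ is_pmf pi
  /\ invariant_for P pi
  /\ (forall x : nat * D,
        tv_norm (fun A : set (nat * D) => P t x A - mass_measure pi A)%E
          @[t --> +oo] --> 0%E).
Proof.
move=> P pi.
have pi_gt0 x : 0 < pi x by exact: queue_pi_gt0.
have pi_sum1 : (\esum_(x in [set: nat * D]) (pi x)%:E = 1)%E by exact: queue_pi_sum1.
have pi_inv t z : 0 <= t ->
    (\esum_(y in [set: nat * D]) (pi y * kernel NZ Pr t y z)%:E = (pi z)%:E)%E.
  apply: (kernel_invariant NZ_markov) => // s u us; exact: queue_pi_subinvariant.
have k_gt0 t x y : 0 < t -> 0 < kernel NZ Pr t x y.
  exact: (queue_kernel_gt0 lambda_gt0 mu_gt0 tau_irr NZ_markov).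
have P_gt0 t x y : 0 < t -> (0 < P t x [set y])%E.
  by move=> t0; rewrite /P (kernelE NZ_markov) ?ltW// lte_fin k_gt0.
split; first exact: XiE.
split; first by move=> x y; exists 1; split; rewrite ?P_gt0.
split.
  (* The skeleton of step [h] can be back in [x] after one step, so the period divides 1. *)
  move=> h x h0 k /(_ 1%N isT); rewrite mulr1n => /(_ (P_gt0 _ _ _ h0)).
  by rewrite dvdn1 => /eqP.
split.
  move=> [n z]; apply: (mean_return_time_lty NZ_markov pi_gt0 pi_sum1 pi_inv).
  (* At time 1 the state [(n.+1, z)] has positive probability, so that of [(n, z)] is below 1. *)
  apply: (kernel_diag_lt1 NZ_markov ler01 _ (k_gt0 1 (n, z) (n.+1, z) ltr01)).
  by rewrite xpair_eqE ltn_eqF.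
split; first by split=> // x; exact: ltW.
split; first exact: (kernel_invariant_for NZ_markov pi_gt0 pi_inv).
by move=> x; exact: (tv_norm_cvg0 NZ_markov pi_gt0 pi_sum1 pi_inv k_gt0).
Qed.
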